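(* For every prime $p$, the function $\rho_p(z)=\dfrac{1-p^{z-1}}{1-p^{-z}}$ is not quasi-inner relative to $\mathbb{C}_-=\{z\in\mathbb{C}\mid\Re(z)\le\frac12\}$.
   Context: The function $\rho_p$ has modulus $1$ on the critical line $\partial\mathbb{C}_-=\{\Re(z)=\frac12\}$. $L^2(\partial\mathbb{C}_-)$ is taken with respect to Lebesgue measure; $H^2(\mathbb{C}_-)\subset L^2(\partial\mathbb{C}_-)$ is the closed subspace of boundary values of holomorphic functions $f$ on $\{\Re(z)<\frac12\}$ with $\sup_{x<1/2}\int_{\mathbb{R}}|f(x+iy)|^2dy<\infty$; $\mathcal{P}$ is the orthogonal projection of $L^2(\partial\mathbb{C}_-)$ onto $H^2(\mathbb{C}_-)$. A function $u\in L^\infty(\partial\mathbb{C}_-)$ of modulus $1$ is quasi-inner relative to $\mathbb{C}_-$ if $(1-\mathcal{P})u\mathcal{P}$ is compact, $u$ acting by multiplication. *)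

(* Defs.v *)
From HB Require Import structures.
From mathcomp Require Import all_boot all_order all_algebra.
From mathcomp Require Import all_classical all_reals all_analysis.
From mathcomp Require Import measurable_realfun complex ring lra.

Set Implicit Arguments.
Unset Strict Implicit.
Unset Printing Implicit Defensive.
Import Order.TTheory GRing.Theory Num.Theory.
Import numFieldNormedType.Exports.
Import ComplexField.Normc.
Local Open Scope classical_set_scope.
Local Open Scope ring_scope.
Local Open Scope complex_scope.

Section critical_line.
Context {R : realType}.
Local Notation C := R[i].
Local Notation mu := (@lebesgue_measure R).
Implicit Types (f g h : R -> C) (u F : C -> C).

(* The line Re z = 1/2 is parameterized by y |-> 1/2 + iy, which carries
   Lebesgue measure to its arc length; a function on the line is represented
   by a function f : R -> C of y. Elements of L^2 are functions, not classes:
   two of them are the same vector when they agree almost everywhere. *)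
Definition crit (y : R) : C := 2^-1 +i* y.

Definition cmeasurable f : Prop :=
  measurable_fun setT (fun y => complex.Re (f y)) /\
  measurable_fun setT (fun y => complex.Im (f y)).

Definition norm2 f : \bar R := ('N[mu]_2%:E [ EFin \o (@normc R \o f) ])%E.

Definition L2 : set (R -> C) :=
  [set f | cmeasurable f /\ (norm2 f < +oo)%E].

Definition inner f g : C :=
  \int[mu]_y complex.Re (f y * conjc (g y)) +i*
  \int[mu]_y complex.Im (f y * conjc (g y)).

(* The library does not declare C itself as a normed module over C; its copy
   C^o is one, so derivability along 1 is complex differentiability. *)
Definition holomorphic_left F : Prop :=
  forall z : C, complex.Re z < 2^-1 -> derivable (F : C^o -> C^o) z 1.

Definition hardy_bounded F : Prop :=
  exists M : R, forall x : R, x < 2^-1 ->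
    (\int[mu]_y ((normc (F (x +i* y))) ^+ 2)%:E <= M%:E)%E.

(* Boundary values are limits in the L^2 norm of the restrictions of F to the
   vertical lines approaching the critical line from the left. *)
Definition boundary_value F g : Prop :=
  norm2 (fun y => F (x +i* y) - g y) @[x --> (2^-1 : R)^'-] --> (0 : \bar R)%E.

Definition H2 : set (R -> C) :=
  [set g | L2 g /\
    exists F, [/\ holomorphic_left F, hardy_bounded F & boundary_value F g]].

Definition is_hardy_proj f g : Prop :=
  H2 g /\ forall h, H2 h -> inner (f \- g) h = 0.

(* H2 is closed in L^2, so every f in L2 has an orthogonal projection, unique
   up to a.e. equality. xget selects a representative; its default value 0
   plays no role for f in L2. *)
Definition hardy_proj f : R -> C := xget (fun=> 0) [set g | is_hardy_proj f g].

Definition compact_operator (T : (R -> C) -> (R -> C)) : Prop :=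
  forall f_ : nat -> R -> C,
    (forall n, L2 (f_ n)) ->
    (exists M : R, forall n, (norm2 (f_ n) <= M%:E)%E) ->
    exists phi : nat -> nat, {homo phi : m n / (m < n)%N} /\
    exists2 g, L2 g &
      norm2 (T (f_ (phi n)) \- g) @[n --> \oo] --> (0 : \bar R)%E.

Definition unimodular u : Prop :=
  cmeasurable (u \o crit) /\ {ae mu, forall y, normc (u (crit y)) = 1}.

Definition mulop u f : R -> C := fun y => u (crit y) * f y.

(* (1 - P) u P *)
Definition hankel u f : R -> C :=
  let v := mulop u (hardy_proj f) in v \- hardy_proj v.

Definition quasi_inner u : Prop := unimodular u /\ compact_operator (hankel u).

Definition cexp (z : C) : C :=
  (expR (complex.Re z))%:C * (cos (complex.Im z) +i* sin (complex.Im z)).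

Definition natpow (p : nat) (z : C) : C := cexp (z * (ln (p%:R : R))%:C).

(* The denominator vanishes only on Re z = 0. *)
Definition rho (p : nat) (z : C) : C :=
  (1 - natpow p (z - 1)) / (1 - natpow p (- z)).

End critical_line.

Section rho_unimodular.
Context {R : realType}.
Local Notation C := R[i].

(* Hence ~ quasi_inner (rho p) says exactly that hankel (rho p) is not
   compact. *)
Lemma rho_unimodular (p : nat) : prime p -> unimodular (@rho R p).
Proof.
move=> pp; set L : R := ln p%:R.
set A := fun y : R => 1 - expR (- (2^-1) * L) * cos (y * L).
set B := fun y : R => expR (- (2^-1) * L) * sin (y * L).
have L0 : 0 < L by rewrite ln_gt0// ltr1n prime_gt1.
have a1 : expR (- (2^-1) * L) < 1.
  by rewrite expR_lt1 mulNr oppr_lt0 mulr_gt0// invr_gt0.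
have A0 y : 0 < A y.
  rewrite subr_gt0 (le_lt_trans _ a1)//.
  by rewrite ler_piMr ?expR_ge0// cos_le1.
have D0 y : A y ^+ 2 + B y ^+ 2 != 0.
  by rewrite gt_eqF// ltr_wpDr ?sqr_ge0// exprn_gt0.
have num y : 1 - natpow p (crit y - 1) = A y -i* B y.
  rewrite /natpow /cexp /crit /= -/L; simpc.
  have -> : (2^-1 - 1) = - (2^-1) :> R by lra.
  by rewrite /A /B; simpc.
have den y : 1 - natpow p (- crit y) = A y +i* B y.
  rewrite /natpow /cexp /crit /= -/L; simpc.
  by rewrite cosN sinN /A /B mulNr; simpc.
have rhoE y : rho p (crit y) =
    ((A y ^+ 2 - B y ^+ 2) / (A y ^+ 2 + B y ^+ 2))
    +i* (- (2 * A y * B y) / (A y ^+ 2 + B y ^+ 2)).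
  rewrite /rho num den; set a := A y; set b := B y.
  have ab0 : a ^+ 2 + b ^+ 2 != 0 by exact: D0.
  have -> : (a +i* b)^-1 =
      (a / (a ^+ 2 + b ^+ 2)) -i* (b / (a ^+ 2 + b ^+ 2)) by [].
  by simpc; congr (_ +i* _); field.
have cA : continuous A.
  move=> y; apply: cvgB; first exact: cvg_cst.
  apply: cvgM; first exact: cvg_cst.
  apply: (@cvg_comp _ _ _ (fun y => y * L) cos _ (nbhs (y * L))).
    by apply: cvgM; [exact: cvg_id|exact: cvg_cst].
  exact: continuous_cos.
have cB : continuous B.
  move=> y; apply: cvgM; first exact: cvg_cst.
  apply: (@cvg_comp _ _ _ (fun y => y * L) sin _ (nbhs (y * L))).
    by apply: cvgM; [exact: cvg_id|exact: cvg_cst].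
  exact: continuous_sin.
have cD : continuous (fun y => (A y ^+ 2 + B y ^+ 2)^-1).
  move=> y; apply: cvgV; first exact: D0.
  by rewrite !expr2; apply: cvgD; apply: cvgM; [exact: cA|exact: cA|exact: cB|exact: cB].
split; last first.
  apply: aeW => y; rewrite rhoE /normc -[RHS]sqrtr1; congr Num.sqrt.
  by field; exact: D0.
split.
- have -> : (fun y => complex.Re (((@rho R p) \o crit) y)) =
      (fun y => (A y ^+ 2 - B y ^+ 2) * (A y ^+ 2 + B y ^+ 2)^-1).
    by apply/funext => y; rewrite /comp rhoE.
  apply: continuous_measurable_fun => y; apply: cvgM; last exact: cD.
  by apply: cvgB; apply: cvgM; [exact: cA|exact: cA|exact: cB|exact: cB].
- have -> : (fun y => complex.Im (((@rho R p) \o crit) y)) =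
      (fun y => - (2 * A y * B y) * (A y ^+ 2 + B y ^+ 2)^-1).
    by apply/funext => y; rewrite /comp rhoE.
  apply: continuous_measurable_fun => y; apply: cvgM; last exact: cD.
  apply: cvgN; apply: cvgM; last exact: cB.
  by apply: cvgM; [exact: cvg_cst|exact: cA].
Qed.

End rho_unimodular.

(* Main.v *)
Require Import Defs.
From mathcomp Require Import all_boot all_order all_algebra.
From mathcomp Require Import all_classical all_reals all_analysis.
From mathcomp Require Import complex.
From mathcomp Require Import measurable_realfun ring lra.

Set Implicit Arguments.
Unset Strict Implicit.
Unset Printing Implicit Defensive.
Import Order.TTheory GRing.Theory Num.Theory.
Import numFieldNormedType.Exports.
Import ComplexField.Normc.
Local Open Scope classical_set_scope.
Local Open Scope ring_scope.
Local Open Scope complex_scope.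

(** Write l = log p, q = p^(-1/2) and s(z) = p^(z - 1/2), a function of modulus
    at most 1 on the half-plane and of modulus 1 on the critical line, where
    s^* = 1/s. With u = 1 - q s, the symbol rho_p equals u / u^* on the line.
    It is invariant under the translation by the period T = 2 pi / l of the
    line, so a nonzero image under the Hankel operator can be translated off to
    infinity, which is incompatible with compactness. The proof makes this
    explicit, with a sequence of test functions detecting the images.

    Put c_n = 1/2 + i n T, where s = 1, and
      f_n = (s - 1) / (u (z - c_n)),  h_n = (s - 1) / (z - c_n),
      k_n = h_n + q^2 f_n.
    These are Hardy functions, because s - 1 vanishes at c_n (H2_quotient). An
    algebraic identity (rho_product_id) says that on the line
      rho_p f_n k_n = h_n^2 + q |f_n|^2.
    The integral of the product of a Hardy function with h_n or k_n is 0
    (H2_pairing_quotient). Hence h_n^2 integrates to 0, and the Hardy projection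
    subtracted in the Hankel operator does not contribute to its pairing with
    k_n (hankel_pairing): the integral of ((1 - P) rho_p P f_n) k_n has real part
    q ||f_n||^2, which is bounded below (energy_source_ge). If the images of a
    subsequence of the bounded sequence f_n converged to g in norm, the pairing
    of g with k_n would be bounded below along it; but k_n is bounded and tends
    to 0 pointwise, hence weakly (weak_cvg0).

    That the product of two Hardy functions F, H has integral 0 on the line is
    Cauchy's theorem (hardy_pairing). The form Im(F H) dx + Re(F H) dy is closed;
    its coefficients are differentiable, but nothing is known about the
    continuity of their derivatives, so Goursat's bisection is used (goursat).
    Horizontal sides of tall rectangles are made negligible by Tonelli's theorem,
    so the integral of Re(F H) is the same on all vertical lines
    (vertical_integral_constant), and it tends to 0 far to the left when H decays
    there in L^2. Pairings are estimated by the inequality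
    |g k| <= e |g|^2 + |k|^2 / e, with e chosen each time. *)

(** * Circulation of a closed differential form around rectangles *)

Section circulation.
Context {R : realType}.
Local Notation mu := (@lebesgue_measure R).
Implicit Types (f g : R -> R) (a b c d h : R) (P Q : R -> R -> R).

Lemma integrableB_EFin (D : set R) f g : measurable D ->
  mu.-integrable D (EFin \o f) -> mu.-integrable D (EFin \o g) ->
  mu.-integrable D (EFin \o (fun x => f x - g x)).
Proof.
move=> mD fi gi.
by rewrite (_ : _ \o _ = (EFin \o f) \- (EFin \o g))%E//; exact: integrableB.
Qed.

Lemma continuous_itv_integrable f a b :
  {in `[a, b], continuous f} -> mu.-integrable `[a, b] (EFin \o f).
Proof.
move=> cf; apply: continuous_compact_integrable; first exact: segment_compact.
apply: continuous_in_subspaceT => x; rewrite inE/= => xab.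
by apply: cf.
Qed.

Lemma Rintegral_itv_cst a b e : a <= b ->
  \int[mu]_(x in `[a, b]) e = e * (b - a).
Proof.
move=> ab; rewrite Rintegral_cst//= lebesgue_measure_itv/= lte_fin.
by case: ltgtP ab => //= -> _; rewrite subrr.
Qed.

Lemma normr_Rintegral_itv_le f a b e : a <= b ->
  {in `[a, b], continuous f} -> {in `[a, b], forall x, `|f x| <= e} ->
  `|\int[mu]_(x in `[a, b]) f x| <= e * (b - a).
Proof.
move=> ab cf fe; have fi := continuous_itv_integrable cf.
apply: (le_trans (le_normr_Rintegral _ fi)) => //.
rewrite -Rintegral_itv_cst//; apply: le_Rintegral => //.
- exact: integrable_norm.
- by apply: continuous_itv_integrable => x _; exact: cvg_cst.
Qed.

Lemma Rintegral_itv_split f a m b : a <= m -> m <= b ->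
  {in `[a, b], continuous f} ->
  \int[mu]_(x in `[a, b]) f x =
  \int[mu]_(x in `[a, m]) f x + \int[mu]_(x in `[m, b]) f x.
Proof.
move=> am mb cf; have fi := continuous_itv_integrable cf.
apply/eqP; rewrite addrC -subr_eq; apply/eqP.
rewrite Rintegral_itvB// Rintegral_itv_obnd_cbnd//.
apply: integrableS fi => //; apply: subset_itv; by rewrite bnd_simp.
Qed.


(** First-order expansion of a function of two real variables, with remainder
    measured in the l1 norm. *)
Definition has_gradient P x y px py := forall e, 0 < e -> exists2 r, 0 < r &
  forall x' y', `|x' - x| <= r -> `|y' - y| <= r ->
    `|P x' y' - P x y - px * (x' - x) - py * (y' - y)|
      <= e * (`|x' - x| + `|y' - y|).

Lemma has_gradient_continuous P x y px py : has_gradient P x y px py ->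
  forall e, 0 < e -> exists2 r, 0 < r &
  forall x' y', `|x' - x| <= r -> `|y' - y| <= r -> `|P x' y' - P x y| <= e.
Proof.
move=> gP e e0; have [r r0 rP] := gP 1 ltr01.
set K := 2 + `|px| + `|py|.
have K0 : 0 < K by rewrite /K; have := normr_ge0 px; have := normr_ge0 py; lra.
exists (Num.min r (e / K)) => [|x' y' hx hy].
  by rewrite lt_min r0 divr_gt0.
move: hx hy; rewrite !le_min => /andP[hx hx'] /andP[hy hy'].
have := rP _ _ hx hy; rewrite mul1r => hP.
have -> : P x' y' - P x y =
    (P x' y' - P x y - px * (x' - x) - py * (y' - y))
    + (px * (x' - x) + py * (y' - y)) by ring.
apply: (le_trans (ler_normD _ _)).
apply: (@le_trans _ _ (K * (e / K))); last by rewrite mulrC divfK ?gt_eqF.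
apply: (@le_trans _ _ (`|x' - x| + `|y' - y| + (`|px| * `|x' - x| + `|py| * `|y' - y|))).
  apply: lerD => //; apply: (le_trans (ler_normD _ _)).
  by rewrite !normrM.
rewrite {1}/K !mulrDl.
have h1 : `|px| * `|x' - x| <= `|px| * (e / K) by exact: ler_wpM2l.
have h2 : `|py| * `|y' - y| <= `|py| * (e / K) by exact: ler_wpM2l.
lra.
Qed.

(** P dx + Q dy is closed on the half-plane x < h: pq is both the derivative
    of P in y and the derivative of Q in x. *)
Definition closed_form P Q (h : R) := forall x y, x < h ->
  exists px pq qy, has_gradient P x y px pq /\ has_gradient Q x y pq qy.

Lemma has_gradient_continuousl P x y px py : has_gradient P x y px py ->
  {for x, continuous (P^~ y)}.
Proof.
move=> /has_gradient_continuous gP; apply/cvgrPdist_le => e e0.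
have [r r0 rP] := gP e e0.
apply/nbhs_ballP; exists r => //= z; rewrite /ball/= => zr.
by rewrite distrC; apply: rP; rewrite ?subrr ?normr0 ?ltW// distrC.
Qed.

Lemma has_gradient_continuousr P x y px py : has_gradient P x y px py ->
  {for y, continuous (P x)}.
Proof.
move=> /has_gradient_continuous gP; apply/cvgrPdist_le => e e0.
have [r r0 rP] := gP e e0.
apply/nbhs_ballP; exists r => //= z; rewrite /ball/= => zr.
by rewrite distrC; apply: rP; rewrite ?subrr ?normr0 ?ltW// distrC.
Qed.

Section rectangles.
Variables (P Q : R -> R -> R) (h : R).
Hypothesis PQ : closed_form P Q h.

Let contPx (x y : R) : x < h -> {for x, continuous (P^~ y)}.
Proof. by move=> /PQ-/(_ y)[? [? [? [/has_gradient_continuousl]]]]. Qed.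
Let contPy (x y : R) : x < h -> {for y, continuous (P x)}.
Proof. by move=> /PQ-/(_ y)[? [? [? [/has_gradient_continuousr]]]]. Qed.
Let contQy (x y : R) : x < h -> {for y, continuous (Q x)}.
Proof. by move=> /PQ-/(_ y)[? [? [? [_ /has_gradient_continuousr]]]]. Qed.

(** The counterclockwise integral of P dx + Q dy around the rectangle with
    lower left corner (a, c) and sides w, k; each integral combines two
    opposite sides, so that only increments of P and Q occur. *)
Definition circulation a c (w k : R) :=
  \int[mu]_(x in `[a, a + w]) (P x c - P x (c + k)) +
  \int[mu]_(y in `[c, c + k]) (Q (a + w) y - Q a y).

Lemma circulation_splitx a c (w w' k : R) : 0 <= w -> 0 <= w' -> a + w + w' < h ->
  circulation a c (w + w') k = circulation a c w k + circulation (a + w) c w' k.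
Proof.
move=> w0 w'0 awh; rewrite /circulation addrA.
have -> : \int[mu]_(x in `[a, a + w + w']) (P x c - P x (c + k)) =
    \int[mu]_(x in `[a, a + w]) (P x c - P x (c + k)) +
    \int[mu]_(x in `[a + w, a + w + w']) (P x c - P x (c + k)).
  apply: Rintegral_itv_split; [lra|lra|].
  move=> x; rewrite in_itv/= => /andP[ax xb].
  by apply: cvgB; apply: contPx; lra.
have Qi z : z < h -> mu.-integrable `[c, c + k] (EFin \o Q z).
  by move=> zh; apply: continuous_itv_integrable => y _; exact: contQy.
have [Q1 Q2 Q3] : [/\ a < h, a + w < h & a + w + w' < h] by split; lra.
by rewrite !(RintegralB _ (Qi _ _) (Qi _ _))//; ring.
Qed.

Lemma circulation_splity a c (w k k' : R) : 0 <= k -> 0 <= k' -> 0 <= w -> a + w < h ->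
  circulation a c w (k + k') = circulation a c w k + circulation a (c + k) w k'.
Proof.
move=> k0 k'0 w0 awh; rewrite /circulation addrA.
have -> : \int[mu]_(y in `[c, c + k + k']) (Q (a + w) y - Q a y) =
    \int[mu]_(y in `[c, c + k]) (Q (a + w) y - Q a y) +
    \int[mu]_(y in `[c + k, c + k + k']) (Q (a + w) y - Q a y).
  apply: Rintegral_itv_split; [lra|lra|].
  by move=> x _; apply: cvgB; apply: contQy; lra.
have Pi z : mu.-integrable `[a, a + w] (EFin \o P^~ z).
  apply: continuous_itv_integrable => y; rewrite in_itv/= => /andP[_ ?].
  by apply: contPx; lra.
by rewrite !(RintegralB _ (Pi _) (Pi _))//; ring.
Qed.

(** If P grows like m in y and Q grows like m in x, the two linear parts
    contribute opposite multiples m w k of the area and cancel; only the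
    deviations e are left, integrated over half of the perimeter. *)
Lemma circulation_le a c (w k m e : R) : 0 <= w -> 0 <= k -> a + w < h ->
  {in `[a, a + w], forall x, `|P x c - P x (c + k) + m * k| <= e} ->
  {in `[c, c + k], forall y, `|Q (a + w) y - Q a y - m * w| <= e} ->
  `|circulation a c w k| <= e * (w + k).
Proof.
move=> w0 k0 awh hP hQ; rewrite /circulation.
set f := fun x => P x c - P x (c + k) + m * k.
set g := fun y => Q (a + w) y - Q a y - m * w.
have cf : {in `[a, a + w], continuous f}.
  move=> x; rewrite in_itv/= => /andP[ax xb].
  by apply: cvgD; [apply: cvgB; apply: contPx; lra|exact: cvg_cst].
have cg : {in `[c, c + k], continuous g}.
  move=> x _; apply: cvgB; last exact: cvg_cst.
  by apply: cvgB; apply: contQy; lra.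
have -> : \int[mu]_(x in `[a, a + w]) (P x c - P x (c + k)) =
    \int[mu]_(x in `[a, a + w]) f x - m * k * w.
  rewrite {3}(_ : w = a + w - a); last by ring.
  rewrite -Rintegral_itv_cst; last lra.
  rewrite -RintegralB//.
  - by apply: eq_Rintegral => x _; rewrite /f addrK.
  - exact: continuous_itv_integrable.
  - by apply: continuous_itv_integrable => x _; exact: cvg_cst.
have -> : \int[mu]_(y in `[c, c + k]) (Q (a + w) y - Q a y) =
    \int[mu]_(x in `[c, c + k]) g x + m * w * k.
  rewrite {3}(_ : k = c + k - c); last by ring.
  rewrite -Rintegral_itv_cst; last lra.
  rewrite -RintegralD//.
  - by apply: eq_Rintegral => x _; rewrite /g subrK.
  - exact: continuous_itv_integrable.
  - by apply: continuous_itv_integrable => x _; exact: cvg_cst.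
have h1 : `|\int[mu]_(x in `[a, a + w]) f x| <= e * w.
  by rewrite {2}(_ : w = a + w - a); [apply: normr_Rintegral_itv_le => //; lra|ring].
have h2 : `|\int[mu]_(x in `[c, c + k]) g x| <= e * k.
  by rewrite {2}(_ : k = c + k - c); [apply: normr_Rintegral_itv_le => //; lra|ring].
rewrite (_ : _ + _ = \int[mu]_(x in `[a, a + w]) f x + \int[mu]_(x in `[c, c + k]) g x); last by ring.
by rewrite (le_trans (ler_normD _ _))// mulrDr lerD.
Qed.

End rectangles.

End circulation.

(** * Goursat's theorem *)

Section goursat_theorem.
Context {R : realType}.
Local Notation mu := (@lebesgue_measure R).

Lemma nested_segments (u d : nat -> R) : (forall n, 0 <= d n) ->
  (forall n, u n <= u n.+1) -> (forall n, u n.+1 + d n.+1 <= u n + d n) ->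
  exists x, forall n, u n <= x <= u n + d n.
Proof.
move=> d0 uS dS.
have u_ndecr m n : (m <= n)%N -> u m <= u n.
  by move=> /subnK <-; elim: (n - m)%N => // i /le_trans; apply; rewrite addSn.
have ud_nincr m n : (m <= n)%N -> u n + d n <= u m + d m.
  move=> /subnK <-; elim: (n - m)%N => // i; rewrite addSn.
  exact: le_trans.
have uub m n : u n <= u m + d m.
  case: (leqP m n) => mn.
    by rewrite (le_trans _ (ud_nincr _ _ mn))// lerDl.
  by rewrite (le_trans (u_ndecr _ _ (ltnW mn)))// lerDl.
exists (sup (range u)) => n; apply/andP; split.
- apply: ub_le_sup; last by exists n.
  by exists (u 0%N + d 0%N) => _ [m _ <-].
- apply: ge_sup; first by exists (u 0%N), 0%N.
  by move=> _ [m _ <-].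
Qed.

Section rectangle.
Variables (P Q : R -> R -> R) (h : R).
Hypothesis PQ : closed_form P Q h.

(** If all four quarters had small circulation, so would the rectangle. *)
Lemma circulation_quarter a c (w k e : R) :
  0 <= w -> 0 <= k -> a + (w + w) < h ->
  4 * e <= `|circulation P Q a c (w + w) (k + k)| ->
  exists a' c', [/\ a <= a', a' <= a + w, c <= c', c' <= c + k &
    e <= `|circulation P Q a' c' w k|].
Proof.
move=> w0 k0 awh; rewrite (circulation_splitx PQ)//; [|lra].
rewrite !(circulation_splity PQ)//; [|lra|lra].
set A := circulation _ _ a c _ _; set B := circulation _ _ a (c + k) _ _.
set C := circulation _ _ (a + w) c _ _.
set D := circulation _ _ (a + w) (c + k) _ _ => big.
have := ler_normD (A + B) (C + D).
have := ler_normD A B; have := ler_normD C D.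
move=> nCD nAB nABCD.
have [eA|eA] := leP e `|A|; first by exists a, c; split => //; lra.
have [eB|eB] := leP e `|B|; first by exists a, (c + k); split => //; lra.
have [eC|eC] := leP e `|C|; first by exists (a + w), c; split => //; lra.
have [eD|eD] := leP e `|D|; first by exists (a + w), (c + k); split => //; lra.
lra.
Qed.

(** To first order the circulation around a small rectangle is the area times
    the difference of the two mixed derivatives, which vanishes. *)
Lemma circulation_small x y e : x < h -> 0 < e ->
  exists2 r, 0 < r & forall X Y (w k : R), 0 <= w -> 0 <= k -> w + k <= r ->
    X <= x <= X + w -> Y <= y <= Y + k -> X + w < h ->
    `|circulation P Q X Y w k| <= e * (w + k) ^+ 2.
Proof.
move=> xh e0; have [px [m [qy [gP gQ]]]] := PQ y xh.
have e20 : 0 < e / 2 by lra.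
have [r1 r10 r1P] := gP _ e20; have [r2 r20 r2P] := gQ _ e20.
exists (Num.min r1 r2) => [|X Y w k w0 k0]; first by rewrite lt_min r10.
rewrite le_min => /andP[wk1 wk2] xX yY Xh.
have bnd F fx fy r (F0 : forall x' y', `|x' - x| <= r -> `|y' - y| <= r ->
    `|F x' y' - F x y - fx * (x' - x) - fy * (y' - y)| <= e / 2 * (`|x' - x| + `|y' - y|)) x' y' :
    w + k <= r -> X <= x' <= X + w -> Y <= y' <= Y + k ->
    `|F x' y' - F x y - fx * (x' - x) - fy * (y' - y)| <= e / 2 * (w + k).
  clear - xX yY F0 e20 w0 k0 => wkr /andP[x'1 x'2] /andP[y'1 y'2].
  move: xX yY => /andP[x1 x2] /andP[y1 y2].
  have nx : `|x' - x| <= w by rewrite ler_norml; lra.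
  have ny : `|y' - y| <= k by rewrite ler_norml; lra.
  apply: (le_trans (F0 _ _ _ _)); [lra|lra|].
  by apply: ler_wpM2l; [exact: ltW|lra].
have bP := bnd P px m r1 r1P; have bQ := bnd Q m qy r2 r2P.
clear - bP bQ w0 k0 wk1 wk2 Xh PQ.
have := @circulation_le _ _ _ _ PQ X Y w k m (e * (w + k)) w0 k0 Xh.
rewrite -mulrA -expr2; apply.
- move=> x'; rewrite in_itv/= => xX.
  have h1 := bP x' Y wk1 xX ltac:(lra).
  have h2 := bP x' (Y + k) wk1 xX ltac:(lra).
  rewrite (_ : _ + _ = (P x' Y - P x y - px * (x' - x) - m * (Y - y)) -
    (P x' (Y + k) - P x y - px * (x' - x) - m * (Y + k - y))); last by ring.
  by rewrite (le_trans (ler_normB _ _))//; lra.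
- move=> y'; rewrite in_itv/= => yY.
  have h1 := bQ X y' wk2 ltac:(lra) yY.
  have h2 := bQ (X + w) y' wk2 ltac:(lra) yY.
  rewrite (_ : _ - _ = (Q (X + w) y' - Q x y - m * (X + w - x) - qy * (y' - y)) -
    (Q X y' - Q x y - m * (X - x) - qy * (y' - y))); last by ring.
  by rewrite (le_trans (ler_normB _ _))//; lra.
Qed.

(** Goursat's argument: repeated quartering isolates a point at which the
    circulation is not of smaller order than the area, whereas the first-order
    expansion there and the equality of the mixed derivatives say that it is. *)
Lemma goursat a c (w k : R) : 0 < w -> 0 < k -> a + w < h ->
  circulation P Q a c w k = 0.
Proof.
move=> w0 k0 awh; apply/eqP; rewrite -normr_eq0; apply/negPn/negP => circ0.
set e := `|circulation P Q a c w k|.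
have e0 : 0 < e by rewrite lt_neqAle eq_sym circ0 /e normr_ge0.
pose W n := w / 2 ^+ n; pose K n := k / 2 ^+ n.
have WS n : W n = W n.+1 + W n.+1 by rewrite /W exprS; field; rewrite expf_neq0.
have KS n : K n = K n.+1 + K n.+1 by rewrite /K exprS; field; rewrite expf_neq0.
have W0 n : 0 < W n by rewrite divr_gt0// exprn_gt0.
have K0 n : 0 < K n by rewrite divr_gt0// exprn_gt0.
pose good n (u : R * R) := u.1 + W n <= a + w /\
  e / 4 ^+ n <= `|circulation P Q u.1 u.2 (W n) (K n)|.
(* Total in n and u, with a dummy value outside the good rectangles, so that
   choice applies. *)
have step (nu : nat * (R * R)) : exists v : R * R, good nu.1 nu.2 ->
    [/\ good nu.1.+1 v, nu.2.1 <= v.1, v.1 + W nu.1.+1 <= nu.2.1 + W nu.1,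
    nu.2.2 <= v.2 & v.2 + K nu.1.+1 <= nu.2.2 + K nu.1].
  case: nu => n [x y] /=.
  have [[/= xW]|ng] := pselect (good n (x, y)); last by exists (0, 0).
  rewrite (WS n) (KS n) => big.
  have [||||x' [y' [h1 h2 h3 h4 h5]]] := @circulation_quarter x y (W n.+1) (K n.+1) (e / 4 ^+ n.+1).
  - exact: ltW.
  - exact: ltW.
  - by rewrite -WS; lra.
  - apply: le_trans big; rewrite exprS le_eqVlt; apply/orP; left; apply/eqP.
    by field; rewrite expf_neq0.
  exists (x', y') => _ /=; split => //=; last 2 first.
  - by rewrite addrA lerD2r.
  - by rewrite addrA lerD2r.
  by split => //=; apply: le_trans xW; rewrite (WS n) addrA lerD2r.
have [f fP] := choice step.
pose u := fix u n := if n is m.+1 then f (m, u m) else (a, c).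
have ug n : good n (u n).
  elim: n => [|n /(fP (n, u n))[]//].
  by rewrite /good /= /W /K !expr0 !divr1.
have uP n := fP (n, u n) (ug n).
have [x xP] : exists x, forall n, (u n).1 <= x <= (u n).1 + W n.
  by apply: nested_segments => n; [exact: ltW|case: (uP n)|case: (uP n)].
have [y yP] : exists x, forall n, (u n).2 <= x <= (u n).2 + K n.
  by apply: nested_segments => n; [exact: ltW|case: (uP n)|case: (uP n)].
have xh : x < h.
  by have /andP[_ /le_lt_trans->//] := xP 0%N; rewrite /= /W expr0 divr1.
set eta := e / (2 * (w + k) ^+ 2).
have wk0 : 0 < w + k by exact: addr_gt0.
have eta0 : 0 < eta by rewrite divr_gt0// mulr_gt0// exprn_gt0.
have [r r0 rP] := circulation_small y xh eta0.
have [n nr] : exists n, (w + k) / 2 ^+ n <= r.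
  exists (Num.bound ((w + k) / r)).
  rewrite ler_pdivrMr ?exprn_gt0// mulrC -ler_pdivrMr//.
  have := archi_boundP (ltW (divr_gt0 wk0 r0)).
  move=> /ltW /le_trans; apply; rewrite -natrX ler_nat.
  by apply: ltnW; apply: ltn_expl.
have [uh big] := ug n.
have := le_trans big (rP _ _ _ _ (ltW (W0 n)) (ltW (K0 n)) _ (xP n) (yP n) (le_lt_trans uh awh)).
have -> : W n + K n = (w + k) / 2 ^+ n by rewrite /W /K -mulrDl.
move=> /(_ nr); rewrite (_ : eta * _ = e / 4 ^+ n / 2).
  rewrite leNgt => /negP; apply.
  have : 0 < e / 4 ^+ n by rewrite divr_gt0// exprn_gt0.
  by clear; move=> ?; lra.
rewrite /eta (_ : 4 = 2 ^+ 2 :> R); last by ring.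
rewrite -exprM mulnC exprM; field.
by rewrite expf_neq0//= gt_eqF.
Qed.

End rectangle.
End goursat_theorem.

(** * Integrals over vertical lines *)

Section line_integrals.
Context {R : realType}.
Local Notation mu := (@lebesgue_measure R).

(** Carathéodory functions are limits of functions that are constant in the
    first variable on the cells of a grid. *)
Lemma caratheodory_measurable (f : R -> R -> R) :
  (forall y, continuous (f^~ y)) -> (forall x, measurable_fun setT (f x)) ->
  measurable_fun setT (fun z : R * R => f z.1 z.2).
Proof.
move=> cf mf.
pose g n (x : R) : R := (Num.floor (x * n.+1%:R))%:~R / n.+1%:R.
have gP n x : g n x <= x < g n x + n.+1%:R^-1.
  have n0 : 0 < n.+1%:R :> R by [].
  have := floor_itv (x * n.+1%:R); rewrite /g intrD -ler_pdivrMr//.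
  by rewrite -ltr_pdivlMr// mulrDl mul1r.
apply: (@measurable_fun_cvg _ _ _ _ (fun n z => f (g n z.1) z.2)).
- move=> n _ Y mY; rewrite setTI.
  have -> : (fun z : R * R => f (g n z.1) z.2) @^-1` Y =
      \bigcup_(k : int) ([set x : R | k%:~R <= x * n.+1%:R < (k + 1)%:~R] `*`
        (f (k%:~R / n.+1%:R) @^-1` Y)).
    apply/seteqP; split => [[x y] /= Yxy|[x y] [k _ [/= kx]]].
      exists (Num.floor (x * n.+1%:R)) => //; split => //=.
      exact: floor_itv.
    by rewrite /g (floor_def kx).
  apply: countable_bigcupT_measurable; first exact: countableP.
  move=> k; apply: measurableX; last by rewrite -[X in measurable X]setTI; exact: mf.
  rewrite (_ : mkset _ = `[k%:~R / n.+1%:R, (k + 1)%:~R / n.+1%:R[%classic); first exact: measurable_itv.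
  by apply/seteqP; split => x /=; rewrite in_itv/= ler_pdivrMr// ltr_pdivlMr.
- move=> [x y] _ /=; apply: (@cvg_comp _ _ _ (fun n => g n x) (f^~ y) _ (nbhs x)).
    apply: (@squeeze_cvgr _ _ _ _ (fun n => x - n.+1%:R^-1) (cst x)).
    + by near=> n; have /andP[h1 h2] := gP n x; rewrite h1 andbT lerBlDr ltW.
    + rewrite -[X in _ --> X]subr0; apply: cvgB; [exact: cvg_cst|exact: cvg_harmonic].
    + exact: cvg_cst.
  exact: cf.
Unshelve. all: end_near. Qed.

(** A nonnegative function of integral at most K is smaller than e somewhere
    on every interval of length more than K / e. *)
Lemma integral_bounded_small (G : R -> \bar R) (K e u v : R) : measurable_fun setT G ->
  (forall y, 0 <= G y)%E -> (\int[mu]_y G y <= K%:E)%E -> 0 < e -> u <= v -> K < e * (v - u) ->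
  exists2 y, u <= y <= v & (G y < e%:E)%E.
Proof.
move=> mG G0 GK e0 uv Kuv; apply: contrapT => noy.
have eG y : `[u, v]%classic y -> (e%:E <= G y)%E.
  by rewrite /= in_itv/= => uyv; rewrite leNgt; apply/negP => ye; apply: noy; exists y.
have : (\int[mu]_(y in `[u, v]) (cst e%:E) y <= K%:E)%E.
  apply: (le_trans _ GK); apply: (@le_trans _ _ (\int[mu]_(y in `[u, v]) G y)%E).
    apply: ge0_le_integral => //; first by move=> *; rewrite lee_fin ltW.
    exact: measurable_funTS.
  by apply: ge0_subset_integral.
rewrite integral_cst//= lebesgue_measure_itv/= lte_fin.
case: ltgtP uv => //= [uv _|uv _]; first by rewrite -EFinB -EFinM lee_fin leNgt Kuv.
by move: Kuv; rewrite uv subrr !mulr0 mule0 lee_fin leNgt => ->.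
Qed.

Section half_plane.
Variables (P Q : R -> R -> R) (h M : R).
Hypothesis PQ : closed_form P Q h.
Hypothesis PM : forall x, x < h -> (\int[mu]_y `|P x y|%:E <= M%:E)%E.
Hypothesis Qi : forall x, x < h -> mu.-integrable setT (EFin \o Q x).

Let contPx (x y : R) : x < h -> {for x, continuous (P^~ y)}.
Proof. by move=> /PQ-/(_ y)[? [? [? [/has_gradient_continuousl]]]]. Qed.
Let contPy (x y : R) : x < h -> {for y, continuous (P x)}.
Proof. by move=> /PQ-/(_ y)[? [? [? [/has_gradient_continuousr]]]]. Qed.

(** By Tonelli's theorem the integral of |P| over the strip between a and b is
    at most M (b - a), so it is small on some horizontal segment. *)
Lemma horizontal_integral_small (a b e u v : R) : a <= b -> b < h ->
  0 < e -> u <= v -> M * (b - a) < e * (v - u) ->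
  exists2 y, u <= y <= v & `|\int[mu]_(x in `[a, b]) P x y| < e.
Proof.
move=> ab bh e0 uv Mlt.
have M0 : 0 <= M.
  rewrite -lee_fin; apply: (le_trans _ (PM bh)).
  by apply: integral_ge0 => y _; rewrite lee_fin.
(* P is only continuous for x < h: clamping x to [a, b] gives a function that
   is continuous in x everywhere. *)
pose cl x := Num.max a (Num.min x b).
have clh x : cl x < h by rewrite /cl gt_max (le_lt_trans ab bh)/= gt_min bh orbT.
have clE x : x \in `[a, b] -> cl x = x.
  by rewrite in_itv/= => /andP[ax xb]; rewrite /cl (min_idPl xb) (max_idPr ax).
have ccl : continuous cl.
  move=> x; apply: (@continuous_max _ _ (cst a) (id \min cst b)); first exact: cvg_cst.
  by apply: (@continuous_min _ _ id (cst b)); [exact: cvg_id|exact: cvg_cst].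
have cP y : continuous (fun x => `|P (cl x) y|).
  move=> x; apply: (@continuous_comp _ _ _ (fun x => P (cl x) y) Num.norm); last exact: norm_continuous.
  by apply: (@continuous_comp _ _ _ cl (P^~ y)); [exact: ccl|exact: contPx].
have mPx x : x < h -> measurable_fun setT (fun y => `|P x y|).
  move=> xh; apply: measurableT_comp => //; apply: continuous_measurable_fun => y.
  exact: contPy.
pose f (z : R * R) : \bar R := (\1_(`[a, b]%classic) z.1 * `|P (cl z.1) z.2|)%:E.
have mf : measurable_fun setT f.
  apply/measurable_EFinP; apply: measurable_funM.
    by apply: measurableT_comp => //; exact: measurable_indic.
  by apply: (@caratheodory_measurable (fun x y => `|P (cl x) y|)) => // x; exact: mPx.
have f0 z : (0 <= f z)%E by rewrite lee_fin mulr_ge0.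
have mG := measurable_fun_fubini_tonelli_G (m1 := mu) f mf f0.
have mF := measurable_fun_fubini_tonelli_F (m2 := mu) f mf f0.
have GM : (\int[mu]_y \int[mu]_x f (x, y) <= (M * (b - a))%:E)%E.
  rewrite -fubini_tonelli//.
  apply: (@le_trans _ _ (\int[mu]_(x in `[a, b]) cst M%:E x)%E).
    rewrite [leRHS]integral_mkcond; apply: ge0_le_integral => //.
    - by move=> x _; exact: integral_ge0.
    - by apply/(measurable_restrictT _ _).1.
    - move=> x _; rewrite patchE; case: ifPn => xab.
        under eq_integral do rewrite /f/= indicE xab mul1r.
        exact: PM.
      rewrite integral0_eq// => y _.
      by rewrite /f/= indicE (negbTE xab) mul0r.
  rewrite integral_cst//= lebesgue_measure_itv/= lte_fin.
  by case: ltgtP ab => //= -> _; rewrite subrr mulr0 mule0.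
have G0 y : (0 <= \int[mu]_x f (x, y))%E by exact: integral_ge0.
have [y uyv Gy] := integral_bounded_small mG G0 GM e0 uv Mlt.
exists y => //; rewrite -lte_fin; apply: le_lt_trans Gy.
have Pi : mu.-integrable `[a, b] (EFin \o P^~ y).
  apply: continuous_itv_integrable => x; rewrite in_itv/= => /andP[ax xb].
  by apply: contPx; exact: le_lt_trans bh.
rewrite EFin_normr_Rintegral//.
apply: (le_trans (le_abse_integral _ _ _)) => //; first exact: measurable_int Pi.
rewrite integral_mkcond le_eqVlt; apply/orP; left; apply/eqP.
apply: eq_integral => x _; rewrite patchE /f/= indicE.
by case: ifPn => xab; rewrite ?mul1r ?mul0r// clE// -inE.
Qed.

(** The circulation vanishes on every rectangle. Since P is integrable over
    vertical strips, there are arbitrarily high and arbitrarily low horizontal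
    sides with negligible contribution, so the two vertical sides agree. *)
Lemma vertical_integral_constant (a b : R) : a < b -> b < h ->
  \int[mu]_y Q a y = \int[mu]_y Q b y.
Proof.
move=> ab bh; have ah : a < h by exact: lt_trans bh.
(* A window of height (n + 1) D contains a segment on which the integral of P
   is less than 1 / (n + 1). *)
pose D := M * (b - a) + 1.
have e0 n : 0 < n.+1%:R^-1 :> R by rewrite invr_gt0.
have M0 : 0 <= M.
  rewrite -lee_fin; apply: (le_trans _ (PM bh)).
  by apply: integral_ge0 => y _; rewrite lee_fin.
have D0 : 0 < D by rewrite /D ltr_pwDr// mulr_ge0// subr_ge0 ltW.
have small n (u : R) : exists2 y, u <= y <= u + n.+1%:R * D &
    `|\int[mu]_(x in `[a, b]) P x y| < n.+1%:R^-1.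
  apply: horizontal_integral_small => //; first exact: ltW.
    by rewrite lerDl mulr_ge0// ltW.
  by rewrite (addrC u) addrK mulKf// /D ltrDl.
have hi n := small n n.+1%:R.
have lo n := small n (- n.+1%:R - n.+1%:R * D).
have {hi}[d dP] := choice (fun n => let: ex_intro2 y p q := hi n in ex_intro (fun y => _ /\ _) y (conj p q)).
have {lo}[c cP] := choice (fun n => let: ex_intro2 y p q := lo n in ex_intro (fun y => _ /\ _) y (conj p q)).
have cn n : c n <= - n.+1%:R by have [/andP[_]] := cP n; rewrite subrK.
have dn n : n.+1%:R <= d n by have [/andP[]] := dP n.
have cd n : c n < d n.
  by apply: (le_lt_trans (cn n)); apply: (lt_le_trans _ (dn n)); rewrite (@lt_trans _ _ 0)// oppr_lt0.
pose q y := Q b y - Q a y.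
have qi : mu.-integrable setT (EFin \o q).
  by apply: integrableB_EFin => //; exact: Qi.
have lim1 : (\int[mu]_(y in `[c n, d n]) (q y)%:E)%E @[n --> \oo] --> (\int[mu]_y (q y)%:E)%E.
  under eq_cvg do rewrite integral_mkcond.
  apply: (@dominated_cvg _ _ _ mu setT measurableT
    (fun n => (EFin \o q) \_ `[c n, d n]%classic) (EFin \o q)
    (abse \o (EFin \o q))) => //.
  - move=> n; apply/(measurable_restrictT _ _).1 => //; apply: measurable_funTS.
    exact: measurable_int qi.
  - move=> y _; apply: cvg_near_cst; near=> n.
    rewrite patchE mem_set//=; rewrite in_itv/=.
    have : `|y| <= n.+1%:R.
      near: n; exists (Num.bound `|y|) => // n /= hn.
      rewrite (le_trans (ltW (archi_boundP _)))// ler_nat.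
      exact: leqW.
    rewrite ler_norml => /andP[h1 h2].
    by rewrite (le_trans (cn n))//= (le_trans h2).
  - exact: integrable_abse.
  - by move=> n y _; rewrite patchE; case: ifPn => //= _; rewrite normr0 lee_fin.
have lim2 : (\int[mu]_(y in `[c n, d n]) (q y)%:E)%E @[n --> \oo] --> 0%E.
  apply/cvg_abse0P.
  apply: (@squeeze_cvge _ _ _ _ (cst 0%E) _ (fun n => (2 * n.+1%:R^-1)%:E)).
  - near=> n; rewrite abse_ge0/=.
    have Qc z : z < h -> mu.-integrable `[c n, d n] (EFin \o Q z).
      by move=> zh; apply: integrableS (Qi zh).
    have qc : mu.-integrable `[c n, d n] (EFin \o q) by exact: integrableS qi.
    rewrite -EFin_normr_Rintegral// lee_fin.
    have := @goursat _ _ _ _ PQ a (c n) (b - a) (d n - c n).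
    rewrite !subr_gt0 /circulation (addrC a) (addrC (c n)) !subrK.
    move=> /(_ ab (cd n) bh) circ0.
    have Pi y : mu.-integrable `[a, b] (EFin \o P^~ y).
      apply: continuous_itv_integrable => x; rewrite in_itv/= => /andP[ax xb].
      by apply: contPx; exact: le_lt_trans bh.
    have -> : \int[mu]_(y in `[c n, d n]) q y =
        \int[mu]_(x in `[a, b]) P x (d n) - \int[mu]_(x in `[a, b]) P x (c n).
      move: circ0; rewrite (RintegralB _ (Pi _) (Pi _))// => /eqP.
      by rewrite addrC addr_eq0 opprB => /eqP.
    have [_ h1] := dP n; have [_ h2] := cP n.
    apply: (le_trans (ler_normB _ _)).
    rewrite mulr_natl mulr2n; apply: lerD; exact: ltW.
  - exact: cvg_cst.
  - apply: cvg_EFin; first by near=> n.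
    rewrite -[X in _ --> X](mulr0 2); apply: cvgM; [exact: cvg_cst|exact: cvg_harmonic].
have := cvg_unique (@ereal_hausdorff R) lim1 lim2 => q0.
apply/eqP; rewrite eq_sym -subr_eq0 -RintegralB//; [|exact: Qi|exact: Qi].
by rewrite /Rintegral q0.
Unshelve. all: end_near. Qed.

End half_plane.
End line_integrals.

(** * Complex differentiability as closedness *)

Section complex_plane.
Context {R : realType}.
Local Notation C := R[i].
Implicit Types (z w : C) (F : C -> C).

Lemma norm_normc z : `|z| = (normc z)%:C.
Proof. by rewrite normc_def; case: z. Qed.

Lemma normc_ge0 z : 0 <= normc z.
Proof. by case: z => a b; rewrite /normc/= sqrtr_ge0. Qed.

Lemma sqr_normcE z : normc z ^+ 2 = complex.Re z ^+ 2 + complex.Im z ^+ 2.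
Proof. by case: z => a b; rewrite /normc/= sqr_sqrtr// addr_ge0// sqr_ge0. Qed.

Lemma normc_leP z (e : R) : 0 <= e ->
  (normc z <= e) = (complex.Re z ^+ 2 + complex.Im z ^+ 2 <= e ^+ 2).
Proof. by move=> e0; rewrite -sqr_normcE ler_sqr ?nnegrE// normc_ge0. Qed.

Lemma normc_leB z w : normc (z - w) <= normc z + normc w.
Proof. by rewrite -(normcN w); exact: le_normcD. Qed.

Lemma normc_gt0 z : z != 0 -> 0 < normc z.
Proof.
move=> z0; rewrite lt_neqAle normc_ge0 andbT eq_sym.
by apply: contra z0 => /eqP/eq0_normc/eqP.
Qed.

Lemma Re_le_normc z : `|complex.Re z| <= normc z.
Proof.
rewrite -(@ler_sqr _ `|_|) ?nnegrE ?normc_ge0// sqr_normcE real_normK ?num_real//.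
by rewrite lerDl sqr_ge0.
Qed.

Lemma Im_le_normc z : `|complex.Im z| <= normc z.
Proof.
rewrite -(@ler_sqr _ `|_|) ?nnegrE ?normc_ge0// sqr_normcE real_normK ?num_real//.
by rewrite lerDr sqr_ge0.
Qed.

Lemma normc_le_ReIm z : normc z <= `|complex.Re z| + `|complex.Im z|.
Proof.
rewrite normc_leP ?addr_ge0// sqrrD !real_normK ?num_real//.
by rewrite addrAC lerDl mulrn_wge0// mulr_ge0.
Qed.

(** Complex differentiability in terms of the real-valued modulus, in which all
    the estimates are carried out. *)
Lemma derivable_normcP F z : derivable (F : C^o -> C^o) z 1 <->
  exists d, forall e : R, 0 < e -> exists2 r : R, 0 < r &
    forall w, normc w <= r -> normc (F (z + w) - F z - d * w) <= e * normc w.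
Proof.
split=> [/cvg_ex[/= d]/cvgrPdist_le dF|[d dF]].
- exists d => e e0; have e0C : 0 < (e%:C : C) by rewrite ltcR.
  have := dF _ e0C; rewrite /dnbhs /within/= => /nbhs_ballP[r /= r0].
  have rR : r = (complex.Re r)%:C.
    by move: r0; case: (r) => a b; rewrite ltcE/= => /andP[/eqP -> _].
  move=> rP; exists (complex.Re r / 2).
    by rewrite divr_gt0//; move: r0; rewrite rR ltcR.
  move=> w wr; have [->|w0] := eqVneq w 0.
    by rewrite addr0 subrr mulr0 subr0 normc0 mulr0.
  have := rP w; rewrite /ball/= sub0r normrN norm_normc => /(_ _ w0).
  have wr' : normc w < complex.Re r.
    by rewrite (le_lt_trans wr)// ltr_pdivrMr// ltr_pMr ?ltr1n//; move: r0; rewrite rR ltcR.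
  rewrite {1}rR ltcR => /(_ wr').
  rewrite norm_normc lecR scaler1 (addrC w) => hw.
  have -> : F (z + w) - F z - d * w = - (d - w^-1 * (F (z + w) - F z)) * w.
    by rewrite opprB mulrBl mulrAC mulVf// mul1r.
  by rewrite normcM normcN; apply: ler_wpM2r; rewrite ?normc_ge0.
- apply/cvg_ex; exists d; apply/cvgrPdist_le => /= e e0.
  have eR : e = (complex.Re e)%:C.
    by move: e0; case: (e) => a b; rewrite ltcE/= => /andP[/eqP -> _].
  have e0R : 0 < complex.Re e by move: e0; rewrite eR ltcR.
  have [r r0 rP] := dF _ e0R.
  have r0C : 0 < (r%:C : C) by rewrite ltcR.
  apply/nbhs_ballP; exists r%:C => //= w; rewrite /ball/= sub0r normrN norm_normc ltcR => wr w0.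
  rewrite norm_normc eR lecR scaler1 (addrC w).
  have -> : d - w^-1 *: (F (z + w) - F z : C^o) = - (F (z + w) - F z - d * w) * w^-1.
    by rewrite opprB mulrBl mulfK// [_ *: _]mulrC.
  rewrite normcM normcN normcV ler_pdivrMr ?normc_gt0//.
  exact/rP/ltW.
Qed.

(** The Cauchy-Riemann equations say that Im F dx + Re F dy is closed. *)
Lemma holomorphic_left_closed_form F : holomorphic_left F ->
  closed_form (fun x y => complex.Im (F (x +i* y)))
    (fun x y => complex.Re (F (x +i* y))) 2^-1.
Proof.
move=> hF x y x2; have /derivable_normcP[d dF] := hF (x +i* y) x2.
exists (complex.Im d), (complex.Re d), (- complex.Im d).
have key e : 0 < e -> exists2 r, 0 < r &
  forall x' y', `|x' - x| <= r -> `|y' - y| <= r ->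
   normc (F (x' +i* y') - F (x +i* y) - d * ((x' - x) +i* (y' - y)))
     <= e * (`|x' - x| + `|y' - y|).
  move=> /[dup] e0 /dF[r r0 rP]; exists (r / 2) => [|x' y' hx hy]; first lra.
  have nw := normc_le_ReIm ((x' - x) +i* (y' - y)).
  have := rP ((x' - x) +i* (y' - y)) ltac:(move: nw => /=; lra).
  have -> : x +i* y + ((x' - x) +i* (y' - y)) = x' +i* y'.
    by simpc; congr (_ +i* _); ring.
  move=> /le_trans; apply; apply: ler_wpM2l => //; exact: ltW.
split => e /key[r r0 rP]; exists r => // x' y' hx hy.
- apply: le_trans (rP _ _ hx hy); apply: le_trans (Im_le_normc _).
  rewrite le_eqVlt; apply/orP; left; apply/eqP; congr `|_|.
  clear rP dF key; move: (F _) (F _) d => [? ?] [? ?] [? ?] /=; ring.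
- apply: le_trans (rP _ _ hx hy); apply: le_trans (Re_le_normc _).
  rewrite le_eqVlt; apply/orP; left; apply/eqP; congr `|_|.
  clear rP dF key; move: (F _) (F _) d => [? ?] [? ?] [? ?] /=; ring.
Qed.

End complex_plane.

(** * Square-integrable functions *)

Section square_integrable.
Context {R : realType}.
Local Notation C := R[i].
Local Notation mu := (@lebesgue_measure R).
Implicit Types (f g h : R -> C).

Lemma cvge0_leP {T : Type} {F : set_system T} {FF : Filter F} (u : T -> \bar R) :
  (forall t, 0 <= u t)%E ->
  u @ F --> 0%E <-> forall e : R, 0 < e -> \forall t \near F, (u t <= e%:E)%E.
Proof.
move=> u0; split.
- move=> /fine_cvgP[ufin /cvgrPdist_le uF] e e0.
  near=> t; have tfin : u t \is a fin_num by near: t.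
  rewrite -(fineK tfin) lee_fin.
  have : `|0 - fine (u t)| <= e by near: t; exact: uF.
  by rewrite sub0r normrN ger0_norm// fine_ge0.
- move=> uF; have fin : \forall t \near F, u t \is a fin_num.
    near=> t; rewrite ge0_fin_numE//; apply: (@le_lt_trans _ _ 1%:E); last exact: ltry.
    by near: t; exact: uF.
  apply/fine_cvgP; split => //; apply/cvgrPdist_le => e e0.
  near=> t; have tfin : u t \is a fin_num by near: t.
  rewrite sub0r normrN ger0_norm ?fine_ge0// -lee_fin fineK//.
  by near: t; exact: uF.
Unshelve. all: end_near. Qed.

(** The square of the L^2 norm. *)
Definition energy f : \bar R := (\int[mu]_y ((normc (f y)) ^+ 2)%:E)%E.

Lemma energy_ge0 f : (0 <= energy f)%E.
Proof. by apply: integral_ge0 => y _; rewrite lee_fin sqr_ge0. Qed.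

Lemma norm2E f : norm2 f = sqrte (energy f).
Proof.
rewrite /norm2 unlock poweR12_sqrt; last first.
  by apply: integral_ge0 => y _; exact: poweR_ge0.
congr sqrte; apply: eq_integral => y _.
have -> : (`|(EFin \o (@normc R \o f)) y| = (normc (f y))%:E)%E.
  by rewrite /= ger0_norm ?normc_ge0.
by rewrite poweR_EFin powR_mulrn// normc_ge0.
Qed.

Lemma norm2_le f (e : R) : 0 <= e -> (norm2 f <= e%:E)%E = (energy f <= (e ^+ 2)%:E)%E.
Proof.
move=> e0; rewrite norm2E; have := energy_ge0 f; case: (energy f) => //= r.
rewrite !lee_fin => r0; by rewrite -[in RHS](sqr_sqrtr r0) ler_sqr ?nnegrE ?sqrtr_ge0.
Qed.

Lemma norm2_ge0 f : (0 <= norm2 f)%E.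
Proof. exact: Lnorm_ge0. Qed.

Lemma norm2_cvg0P {T : Type} {F : set_system T} {FF : Filter F} (u : T -> R -> C) :
  norm2 (u t) @[t --> F] --> 0%E <->
  forall e : R, 0 < e -> \forall t \near F, (energy (u t) <= e%:E)%E.
Proof.
rewrite (cvge0_leP (fun t => norm2_ge0 (u t))); split => uF e e0.
- have se0 : 0 < Num.sqrt e by rewrite sqrtr_gt0.
  apply: filterS (uF _ se0) => t.
  by rewrite norm2_le ?sqrtr_ge0// sqr_sqrtr// ltW.
- apply: filterS (uF _ (exprn_gt0 2 e0)) => t.
  by rewrite norm2_le// ltW.
Qed.

Lemma L2P f : L2 f <-> cmeasurable f /\ exists A : R, (energy f <= A%:E)%E.
Proof.
rewrite /L2/= norm2E; split=> -[mf fE]; split => //.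
- move: fE (energy_ge0 f); case: (energy f) => //= r _ _; by exists r.
- by case: fE (energy_ge0 f) => A; case: (energy f) => //= r _ _; exact: ltry.
Qed.

Lemma cmeasurable_sub f g : cmeasurable f -> cmeasurable g -> cmeasurable (f \- g).
Proof.
move=> [rf jf] [rg jg]; split.
- rewrite (_ : (fun _ => _) = (fun y => complex.Re (f y)) \- (fun y => complex.Re (g y))).
    exact: measurable_funB.
  by apply/funext => y /=; case: (f y) (g y) => ? ? [].
- rewrite (_ : (fun _ => _) = (fun y => complex.Im (f y)) \- (fun y => complex.Im (g y))).
    exact: measurable_funB.
  by apply/funext => y /=; case: (f y) (g y) => ? ? [].
Qed.

Lemma cmeasurable_mul f g : cmeasurable f -> cmeasurable g ->
  cmeasurable (fun y => f y * g y).
Proof.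
move=> [rf jf] [rg jg]; split.
- rewrite (_ : (fun _ => _) = (fun y => complex.Re (f y) * complex.Re (g y)) \-
      (fun y => complex.Im (f y) * complex.Im (g y))).
    by apply: measurable_funB; exact: measurable_funM.
  by apply/funext => y /=; case: (f y) (g y) => ? ? [].
- rewrite (_ : (fun _ => _) = (fun y => complex.Re (f y) * complex.Im (g y)) \+
      (fun y => complex.Im (f y) * complex.Re (g y))).
    by apply: measurable_funD; exact: measurable_funM.
  by apply/funext => y /=; case: (f y) (g y) => ? ? [].
Qed.

Lemma cmeasurable_conj f : cmeasurable f -> cmeasurable (fun y => conjc (f y)).
Proof.
move=> [rf jf]; split.
- rewrite (_ : (fun _ => _) = fun y => complex.Re (f y))//.
  by apply/funext => y; case: (f y).
- rewrite (_ : (fun _ => _) = \- (fun y => complex.Im (f y)))%R; last first.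
    by apply/funext => y /=; case: (f y).
  exact: measurableT_comp.
Qed.

Lemma measurable_sqr_normc f : cmeasurable f ->
  measurable_fun setT (fun y => normc (f y) ^+ 2).
Proof.
move=> [rf jf]; under eq_fun do rewrite sqr_normcE.
by apply: measurable_funD; exact: measurable_funX.
Qed.

Lemma measurable_normc f : cmeasurable f -> measurable_fun setT (fun y => normc (f y)).
Proof.
move=> mf; rewrite (_ : (fun _ => _) = (fun y => Num.sqrt (normc (f y) ^+ 2))).
  exact: (measurableT_comp (continuous_measurable_fun (@sqrt_continuous R)) (measurable_sqr_normc mf)).
by apply/funext => y; rewrite sqrtr_sqr ger0_norm ?normc_ge0.
Qed.

Lemma energy_sub f g (A B : R) : cmeasurable f -> cmeasurable g ->
  (energy f <= A%:E)%E -> (energy g <= B%:E)%E ->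
  (energy (f \- g)%R <= (2 * A + 2 * B)%:E)%E.
Proof.
move=> mf mg fA gB.
apply: (@le_trans _ _ (\int[mu]_y ((2 * normc (f y) ^+ 2)%:E + (2 * normc (g y) ^+ 2)%:E)%E)%E).
  apply: ge0_le_integral => //.
  - by move=> y _; rewrite lee_fin sqr_ge0.
  - by apply/measurable_EFinP; exact: (measurable_sqr_normc (cmeasurable_sub mf mg)).
  - by apply: emeasurable_funD; apply/measurable_EFinP/measurable_funM => //; exact: measurable_sqr_normc.
  - move=> y _; rewrite -EFinD lee_fin.
    apply: (@le_trans _ _ ((normc (f y) + normc (g y)) ^+ 2)).
      by rewrite ler_sqr ?nnegrE ?addr_ge0 ?normc_ge0// normc_leB.
    rewrite -subr_ge0 (_ : _ - _ = (normc (f y) - normc (g y)) ^+ 2) ?sqr_ge0//; ring.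
rewrite ge0_integralD//; first last.
- by apply/measurable_EFinP/measurable_funM => //; exact: measurable_sqr_normc.
- by move=> y _; rewrite lee_fin mulr_ge0// sqr_ge0.
- by apply/measurable_EFinP/measurable_funM => //; exact: measurable_sqr_normc.
- by move=> y _; rewrite lee_fin mulr_ge0// sqr_ge0.
under eq_integral do rewrite EFinM.
under [X in (_ + X)%E]eq_integral do rewrite EFinM.
rewrite !ge0_integralZl//; first last.
- by move=> y _; rewrite lee_fin sqr_ge0.
- by apply/measurable_EFinP; exact: measurable_sqr_normc.
- by move=> y _; rewrite lee_fin sqr_ge0.
- by apply/measurable_EFinP; exact: measurable_sqr_normc.
by rewrite (EFinD (2 * A)) !EFinM; apply: leeD; rewrite lee_pmul2l// lte_fin.
Qed.

Lemma L2_sub f g : L2 f -> L2 g -> L2 (f \- g).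
Proof.
move=> /L2P[mf [A fA]] /L2P[mg [B gB]]; apply/L2P; split.
  exact: cmeasurable_sub.
by exists (2 * A + 2 * B); exact: energy_sub.
Qed.

Lemma L2_conj f : L2 f -> L2 (fun y => conjc (f y)).
Proof.
move=> /L2P[mf [A fA]]; apply/L2P; split; first exact: cmeasurable_conj.
exists A; rewrite (_ : energy _ = energy f)//; apply: eq_integral => y _.
by rewrite !sqr_normcE; case: (f y) => a b /=; rewrite sqrrN.
Qed.

(** Instead of the Cauchy-Schwarz inequality, its linear form with a free
    weight e: all the estimates below let e depend on the case at hand. *)
Lemma young_normc (e : R) (z w : C) : 0 < e ->
  normc (z * w) <= e * normc z ^+ 2 + e^-1 * normc w ^+ 2.
Proof.
move=> e0; rewrite normcM; set a := normc z; set b := normc w.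
have a0 : 0 <= a by exact: normc_ge0.
have b0 : 0 <= b by exact: normc_ge0.
have h : 0 <= e^-1 * (e * a - b) ^+ 2 by rewrite mulr_ge0 ?sqr_ge0// invr_ge0 ltW.
rewrite (_ : e^-1 * _ = e * a ^+ 2 - 2 * (a * b) + e^-1 * b ^+ 2) in h; last first.
  by field; rewrite gt_eqF.
have := mulr_ge0 a0 b0; lra.
Qed.

Lemma integral_normc_mul_le f g (A B e : R) : cmeasurable f -> cmeasurable g ->
  (energy f <= A%:E)%E -> (energy g <= B%:E)%E -> 0 < e ->
  (\int[mu]_y (normc (f y * g y))%:E <= (e * A + e^-1 * B)%:E)%E.
Proof.
move=> mf mg fA gB e0.
have ei0 : 0 < e^-1 by rewrite invr_gt0.
have mn := measurable_normc (cmeasurable_mul mf mg).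
apply: (@le_trans _ _ (\int[mu]_y ((e * normc (f y) ^+ 2)%:E + (e^-1 * normc (g y) ^+ 2)%:E)%E)%E).
  apply: ge0_le_integral => //.
  - by move=> y _; rewrite lee_fin normc_ge0.
  - exact/measurable_EFinP.
  - by apply: emeasurable_funD; apply/measurable_EFinP/measurable_funM => //; exact: measurable_sqr_normc.
  - by move=> y _; rewrite -EFinD lee_fin young_normc.
rewrite ge0_integralD//; first last.
- by apply/measurable_EFinP/measurable_funM => //; exact: measurable_sqr_normc.
- by move=> y _; rewrite lee_fin mulr_ge0 ?sqr_ge0// ltW.
- by apply/measurable_EFinP/measurable_funM => //; exact: measurable_sqr_normc.
- by move=> y _; rewrite lee_fin mulr_ge0 ?sqr_ge0// ltW.
under eq_integral do rewrite EFinM.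
under [X in (_ + X)%E]eq_integral do rewrite EFinM.
rewrite !ge0_integralZl//; try by [rewrite lee_fin ltW|move=> y _; rewrite lee_fin sqr_ge0
  |apply/measurable_EFinP; exact: measurable_sqr_normc].
by rewrite (EFinD (e * A)) !EFinM; apply: leeD; rewrite lee_pmul2l// lte_fin.
Qed.

Lemma L2_mul_integrable f g : L2 f -> L2 g ->
  mu.-integrable setT (EFin \o (fun y => complex.Re (f y * g y))) /\
  mu.-integrable setT (EFin \o (fun y => complex.Im (f y * g y))).
Proof.
move=> /L2P[mf [A fA]] /L2P[mg [B gB]].
have [mr mi] := cmeasurable_mul mf mg.
have fin := integral_normc_mul_le mf mg fA gB ltr01.
have mn := measurable_normc (cmeasurable_mul mf mg).
have ni : mu.-integrable setT (EFin \o (fun y => normc (f y * g y))).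
  apply/integrableP; split; first exact/measurable_EFinP.
  under eq_integral do rewrite /= ger0_norm ?normc_ge0//.
  exact: le_lt_trans fin (ltry _).
split; apply: le_integrable ni => //; try exact/measurable_EFinP;
  move=> y _; rewrite lee_fin [leRHS]ger0_norm ?normc_ge0//.
- exact: Re_le_normc.
- exact: Im_le_normc.
Qed.

Lemma Rintegral_Re_mul_le f g (A B e : R) : L2 f -> L2 g ->
  (energy f <= A%:E)%E -> (energy g <= B%:E)%E -> 0 < e ->
  `|\int[mu]_y complex.Re (f y * g y)| <= e * A + e^-1 * B.
Proof.
move=> f2 g2 fA gB e0; have [ri _] := L2_mul_integrable f2 g2.
rewrite -lee_fin EFin_normr_Rintegral//.
apply: (le_trans (le_abse_integral _ _ _)) => //; first exact: measurable_int ri.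
have /L2P[mf _] := f2; have /L2P[mg _] := g2.
apply: le_trans (integral_normc_mul_le mf mg fA gB e0).
apply: ge0_le_integral => //.
- by apply: measurableT_comp => //; exact: measurable_int ri.
- by apply/measurable_EFinP; exact: (measurable_normc (cmeasurable_mul mf mg)).
- by move=> y _; rewrite lee_fin; exact: Re_le_normc.
Qed.

End square_integrable.

(** * Two Hardy functions have product of integral zero *)

Section hardy_pairing.
Context {R : realType}.
Local Notation C := R[i].
Local Notation mu := (@lebesgue_measure R).
Implicit Types (f g h : R -> C) (F H : C -> C).

Lemma holomorphic_left_mul F H : holomorphic_left F -> holomorphic_left H ->
  holomorphic_left (fun z => F z * H z).
Proof. by move=> hF hH z zl; exact: derivableM (hF z zl) (hH z zl). Qed.

Lemma holomorphic_left_cmeasurable F x : holomorphic_left F -> x < 2^-1 ->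
  cmeasurable (fun y => F (x +i* y)).
Proof.
move=> /holomorphic_left_closed_form cF xl; split;
  apply: continuous_measurable_fun => y;
  have [? [? [? [g1 g2]]]] := cF x y xl.
- exact: (has_gradient_continuousr g2).
- exact: (has_gradient_continuousr g1).
Qed.

Lemma hardy_slice_L2 F : holomorphic_left F -> hardy_bounded F ->
  exists M : R, forall x, x < 2^-1 ->
    L2 (fun y => F (x +i* y)) /\ (energy (fun y => F (x +i* y)) <= M%:E)%E.
Proof.
move=> hF [M FM]; exists M => x xl; split; last exact: FM.
apply/L2P; split; first exact: holomorphic_left_cmeasurable.
by exists M; exact: FM.
Qed.

(** Cauchy's theorem for the product F H, which is integrable over every
    vertical line. *)
Lemma Rintegral_slice_constant F H : holomorphic_left F -> hardy_bounded F ->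
  holomorphic_left H -> hardy_bounded H -> forall a b : R, a < 2^-1 -> b < 2^-1 ->
  \int[mu]_y complex.Re (F (a +i* y) * H (a +i* y)) =
  \int[mu]_y complex.Re (F (b +i* y) * H (b +i* y)).
Proof.
move=> hF bF hH bH.
have [M FM] := hardy_slice_L2 hF bF; have [N HN] := hardy_slice_L2 hH bH.
have cFH := holomorphic_left_closed_form (holomorphic_left_mul hF hH).
have PM x : x < 2^-1 ->
    (\int[mu]_y `|complex.Im (F (x +i* y) * H (x +i* y))|%:E <= (1 * M + 1^-1 * N)%:E)%E.
  move=> xl; have [F2 FxM] := FM _ xl; have [H2 HxN] := HN _ xl.
  have /L2P[mF _] := F2; have /L2P[mH _] := H2.
  apply: le_trans (integral_normc_mul_le mF mH FxM HxN ltr01).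
  have [_ mi] := cmeasurable_mul mF mH.
  apply: ge0_le_integral => //.
  - exact/measurable_EFinP/measurableT_comp.
  - by apply/measurable_EFinP; exact: (measurable_normc (cmeasurable_mul mF mH)).
  - by move=> y _; rewrite lee_fin; exact: Im_le_normc.
have Qi x : x < 2^-1 ->
    mu.-integrable setT (EFin \o (fun y => complex.Re (F (x +i* y) * H (x +i* y)))).
  move=> xl; have [F2 _] := FM _ xl; have [H2 _] := HN _ xl.
  by have [] := L2_mul_integrable F2 H2.
move=> a b al bl; have [ab|ba|->//] := ltgtP a b.
- exact: (vertical_integral_constant cFH PM Qi ab bl).
- by apply/esym; exact: (vertical_integral_constant cFH PM Qi ba al).
Qed.

(** The product of two Hardy functions has the same integral over every
    vertical line; letting the line move to -oo, where H dies out, and to the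
    boundary, the common value is both 0 and the integral of g k. *)
Lemma hardy_pairing F H g k : L2 g -> L2 k ->
  holomorphic_left F -> hardy_bounded F -> boundary_value F g ->
  holomorphic_left H -> hardy_bounded H -> boundary_value H k ->
  (forall e : R, 0 < e -> exists2 x, x < 2^-1 &
     (energy (fun y => H (x +i* y)) <= e%:E)%E) ->
  \int[mu]_y complex.Re (g y * k y) = 0.
Proof.
move=> g2 k2 hF bF Fg hH bH Hk Hdecay.
have [M FM] := hardy_slice_L2 hF bF; have [N HN] := hardy_slice_L2 hH bH.
have /L2P[mg [A gA]] := g2.
have half0 : (0 : R) < 2^-1 by rewrite invr_gt0.
have M0 : 0 <= M.
  by have [_ FxM] := FM _ half0; rewrite -lee_fin; exact: le_trans (energy_ge0 _) FxM.
have N0 : 0 <= N.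
  by have [_ HxN] := HN _ half0; rewrite -lee_fin; exact: le_trans (energy_ge0 _) HxN.
have A0 : 0 <= A by rewrite -lee_fin; exact: le_trans (energy_ge0 _) gA.
apply/eqP; rewrite -normr_le0; apply/ler_addgt0Pr => e e0; rewrite add0r.
(* Each of the three error terms is at most d * K + d^-1 * eta <= e / 3. *)
pose K := M + N + A + 1.
have K0 : 0 < K by rewrite /K; lra.
pose d := e / (6 * K).
have d0 : 0 < d by rewrite divr_gt0// mulr_gt0.
pose eta := d * (e / 6).
have eta0 : 0 < eta by rewrite mulr_gt0// divr_gt0.
have dK B : B <= K -> d * B + d^-1 * eta <= e / 3.
  move=> BK; rewrite /eta mulKf ?gt_eqF//.
  have : d * B <= d * K by rewrite ler_pM2l.
  rewrite {2}/d (_ : e / (6 * K) * K = e / 6); first lra.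
  by field; rewrite gt_eqF.
have [x0 x0l Hx0] := Hdecay _ eta0.
have [x [xl Fgx Hkx]] : exists x : R, [/\ x < 2^-1,
    (energy (fun y => F (x +i* y) - g y)%R <= eta%:E)%E &
    (energy (fun y => H (x +i* y) - k y)%R <= eta%:E)%E].
  have n1 : \forall x \near (2^-1 : R)^'-,
    (energy (fun y => F (x +i* y) - g y)%R <= eta%:E)%E.
    exact: (norm2_cvg0P _).1 Fg _ eta0.
  have n2 : \forall x \near (2^-1 : R)^'-,
    (energy (fun y => H (x +i* y) - k y)%R <= eta%:E)%E.
    exact: (norm2_cvg0P _).1 Hk _ eta0.
  have n0 : \forall x \near (2^-1 : R)^'-, x < 2^-1 by exact: nbhs_left_lt.
  have [x [[xl Fx] Hx]] := filter_ex (filterI (filterI n0 n1) n2).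
  by exists x; split.
have [F2 FxM] := FM _ xl; have [H2 HxN] := HN _ xl.
have Fg2 := L2_sub F2 g2; have Hk2 := L2_sub H2 k2.
have I0 : `|\int[mu]_y complex.Re (F (x +i* y) * H (x +i* y))| <= e / 3.
  rewrite (Rintegral_slice_constant hF bF hH bH xl x0l).
  have [Fx02 FM0] := FM _ x0l; have [Hx02 _] := HN _ x0l.
  apply: le_trans (dK M _); last by rewrite /K; lra.
  exact: Rintegral_Re_mul_le.
have I1 : `|\int[mu]_y complex.Re (H (x +i* y) * (F (x +i* y) - g y))| <= e / 3.
  apply: le_trans (dK N _); last by rewrite /K; lra.
  exact: Rintegral_Re_mul_le.
have I2 : `|\int[mu]_y complex.Re (g y * (H (x +i* y) - k y))| <= e / 3.
  apply: le_trans (dK A _); last by rewrite /K; lra.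
  exact: Rintegral_Re_mul_le.
have [i0 _] := L2_mul_integrable F2 H2.
have [i1 _] := L2_mul_integrable H2 Fg2.
have [i2 _] := L2_mul_integrable g2 Hk2.
have -> : \int[mu]_y complex.Re (g y * k y) =
    \int[mu]_y complex.Re (F (x +i* y) * H (x +i* y))
    - \int[mu]_y complex.Re (H (x +i* y) * (F (x +i* y) - g y))
    - \int[mu]_y complex.Re (g y * (H (x +i* y) - k y)).
  rewrite -RintegralB// -RintegralB//; last first.
    exact: (integrableB_EFin measurableT i0 i1).
  apply: eq_Rintegral => y _ /=.
  case: (F _) (H _) (g y) (k y) => [? ?] [? ?] [? ?] [? ?] /=; ring.
apply: (le_trans (ler_normB _ _)); apply: (le_trans (lerD (ler_normB _ _) (lexx _))).
lra.
Qed.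

End hardy_pairing.

(** * The complex exponential *)

Section exponential.
Context {R : realType}.
Local Notation C := R[i].
Implicit Types (z w : C).

Lemma sin_le_norm (x : R) : `|sin x| <= `|x|.
Proof.
wlog x0 : x / 0 <= x => [hw|].
  have [/hw//|x0] := leP 0 x.
  by have := hw (- x); rewrite oppr_ge0 sinN !normrN; apply; exact: ltW.
have [//|c _] := @MVT_segment R sin cos 0 x x0 (fun x _ => is_derive_sin x).
  exact/continuous_subspaceT/continuous_sin.
rewrite sin0 !subr0 => ->; rewrite normrM.
by rewrite -[leRHS]mul1r ler_wpM2r// cos_max.
Qed.

Lemma cos_le_sqr (x : R) : 1 - cos x <= x ^+ 2 / 2.
Proof.
have -> : x = (x / 2) *+ 2 by rewrite -mulr_natr divfK.
set t := x / 2; rewrite cos_mulr2n.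
have : sin t ^+ 2 <= t ^+ 2.
  by rewrite -[leLHS]real_normK ?num_real// -[leRHS]real_normK ?num_real// ler_sqr ?nnegrE// sin_le_norm.
have := cos2Dsin2 t; rewrite (mulr2n t) (mulr2n (cos t ^+ 2)); lra.
Qed.

Lemma sin_sub_le (x : R) : `|sin x - x| <= `|x| ^+ 3 / 2.
Proof.
wlog x0 : x / 0 <= x => [hw|].
  have [/hw//|x0] := leP 0 x.
  have := hw (- x); rewrite oppr_ge0 => /(_ (ltW x0)).
  by rewrite sinN -opprD !normrN.
have [//|c c0x] := @MVT_segment R sin cos 0 x x0 (fun x _ => is_derive_sin x).
  exact/continuous_subspaceT/continuous_sin.
rewrite sin0 !subr0 => ->; rewrite -{2}(mul1r x) -mulrBl normrM exprSr mulrAC.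
apply: ler_wpM2r => //; rewrite distrC ger0_norm ?subr_ge0 ?cos_le1//.
apply: (le_trans (cos_le_sqr c)); rewrite ler_pM2r ?invr_gt0//.
move: c0x; rewrite in_itv/= => /andP[c0 cx].
by rewrite (ger0_norm x0) ler_sqr ?nnegrE.
Qed.

Lemma expR_sub_le (x : R) : `|x| <= 2^-1 -> `|expR x - 1 - x| <= 2 * x ^+ 2.
Proof.
rewrite ler_norml => /andP[h1 h2].
rewrite ger0_norm; last by have := expR_ge1Dx x; lra.
have : expR x <= (1 - x)^-1.
  rewrite -[expR x]invrK -expRN lef_pV2 ?posrE ?expR_gt0//; last lra.
  by have := expR_ge1Dx (- x).
have -> : (1 - x)^-1 = 1 + x + x ^+ 2 / (1 - x) by field; lra.
have : x ^+ 2 / (1 - x) <= 2 * x ^+ 2.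
  rewrite mulrC ler_wpM2r ?sqr_ge0//.
  by rewrite -[leRHS]invrK lef_pV2 ?posrE//; lra.
lra.
Qed.

Lemma cexpD z w : cexp (z + w) = cexp z * cexp w.
Proof.
case: z w => [a b] [a' b']; rewrite /cexp /=; simpc.
by rewrite expRD cosD sinD; congr (_ +i* _); ring.
Qed.

Lemma normc_cexp z : normc (cexp z) = expR (complex.Re z).
Proof.
case: z => a b; apply/eqP; rewrite -(@eqrXn2 _ 2) ?normc_ge0 ?expR_ge0//.
apply/eqP; rewrite sqr_normcE /cexp /=; simpc => /=.
by rewrite !exprMn -mulrDr cos2Dsin2 mulr1.
Qed.

Lemma cexp_sub1_le w : complex.Re w <= 0 -> normc (cexp w - 1) <= normc w.
Proof.
move=> a0; rewrite normc_leP ?normc_ge0// sqr_normcE.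
case: w a0 => a b /= a0; rewrite /cexp /=; simpc => /=.
have e1 := expR_ge1Dx a; have e0 := expR_gt0 a.
have e2 : expR a <= 1 by rewrite -expR0 ler_expR.
have h1 : (1 - expR a) ^+ 2 <= a ^+ 2.
  by rewrite -[leRHS]sqrrN ler_sqr ?nnegrE; lra.
have h2 : expR a * (1 - cos b) <= b ^+ 2 / 2.
  by apply: le_trans (cos_le_sqr b); apply: ler_piMl; rewrite ?subr_ge0 ?cos_le1.
have := cos2Dsin2 b.
rewrite [leLHS](_ : _ = (1 - expR a) ^+ 2 + 2 * (expR a * (1 - cos b))
   + expR a ^+ 2 * (cos b ^+ 2 + sin b ^+ 2 - 1)); last by ring.
move=> ->; rewrite subrr mulr0 addr0; lra.
Qed.

(** Factor out the exponential of the number with the larger real part. *)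
Lemma cexp_lipschitz z w : complex.Re z <= 0 -> complex.Re w <= 0 ->
  normc (cexp z - cexp w) <= normc (z - w).
Proof.
wlog zw : z w / complex.Re z <= complex.Re w => [hw z0 w0|z0 w0].
  have [h|/ltW h] := leP (complex.Re z) (complex.Re w); first exact: hw.
  by rewrite -normcN opprB -[leRHS]normcN opprB; exact: hw.
have -> : cexp z - cexp w = cexp w * (cexp (z - w) - 1).
  by rewrite mulrBr mulr1 -cexpD (addrC w) subrK.
rewrite normcM -[leRHS]mul1r; apply: ler_pM; rewrite ?normc_ge0//.
  by rewrite normc_cexp -expR0 ler_expR.
by apply: cexp_sub1_le; move: zw; case: (z) (w) => [? ?] [? ?] /=; lra.
Qed.

Lemma cexp_taylor w : normc w <= 2^-1 ->
  normc (cexp w - 1 - w) <= 4 * normc w ^+ 2.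
Proof.
move=> w1; have ha := le_trans (Re_le_normc w) w1.
have hb := le_trans (Im_le_normc w) w1.
rewrite sqr_normcE; apply: (le_trans (normc_le_ReIm _)); move: ha hb {w1}.
case: w => a b /= ha hb; rewrite /cexp /=; simpc => /=.
have := expR_sub_le ha; have := sin_sub_le b; have := cos_le_sqr b.
have := cos_le1 b; set c := cos b; set s := sin b; set e := expR a.
set u := e - 1 - a; set v := s - b => c1 c2 v1 u1.
have -> : e * c - 1 - a = u - e * (1 - c) by rewrite /u; ring.
have -> : e * s - b = (u + a) * b + e * v by rewrite /u /v; ring.
have a2 : `|a| ^+ 2 = a ^+ 2 by rewrite real_normK ?num_real.
have b2 : `|b| ^+ 2 = b ^+ 2 by rewrite real_normK ?num_real.
have na := normr_ge0 a; have nb := normr_ge0 b.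
have u2 : `|u| <= `|a|.
  apply: (le_trans u1); rewrite -a2 expr2 mulrA -[leRHS]mul1r ler_wpM2r//; lra.
have e2 : e <= 2.
  have : `|u + a| <= 1 by rewrite (le_trans (ler_normD _ _))//; lra.
  by rewrite ler_norml /u => /andP[_]; lra.
have e0 : 0 <= e by exact: expR_ge0.
have v2 : `|v| <= b ^+ 2 / 2.
  apply: (le_trans v1); rewrite -b2 exprSr -mulrA mulrCA mulrC.
  by apply: ler_piMr; [rewrite mulr_ge0 ?sqr_ge0|lra].
have t1 : `|u - e * (1 - c)| <= 2 * a ^+ 2 + b ^+ 2.
  apply: (le_trans (ler_normB _ _)); apply: lerD => //.
  rewrite normrM (ger0_norm e0) (ger0_norm (_ : 0 <= 1 - c)) ?subr_ge0//.
  have : e * (1 - c) <= 2 * (b ^+ 2 / 2) by apply: ler_pM; rewrite ?subr_ge0.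
  lra.
have t2 : `|(u + a) * b + e * v| <= a ^+ 2 + b ^+ 2 + b ^+ 2.
  apply: (le_trans (ler_normD _ _)); apply: lerD; rewrite normrM.
    apply: (@le_trans _ _ (2 * `|a| * `|b|)).
      by rewrite ler_wpM2r// (le_trans (ler_normD _ _))//; lra.
    rewrite -a2 -b2 -subr_ge0 (_ : _ - _ = (`|a| - `|b|) ^+ 2) ?sqr_ge0//; ring.
  rewrite (ger0_norm e0).
  have : e * `|v| <= 2 * (b ^+ 2 / 2) by apply: ler_pM.
  lra.
have := sqr_ge0 a; have := sqr_ge0 b; lra.
Qed.

End exponential.

(** * Bounded Lipschitz functions on the half-plane *)

Section half_plane_functions.
Context {R : realType}.
Local Notation C := R[i].
Implicit Types (z w : C) (F N : C -> C).

(** Holomorphic on the open half-plane, bounded and Lipschitz up to the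
    critical line; one constant serves for both bounds. *)
Definition lipschitz_left N := holomorphic_left N /\
  exists2 K : R, 0 <= K & forall z w, complex.Re z <= 2^-1 -> complex.Re w <= 2^-1 ->
    normc (N z) <= K /\ normc (N z - N w) <= K * normc (z - w).

Lemma lipschitz_left_cst (c : C) : lipschitz_left (fun=> c).
Proof.
split; first by move=> z _; exact: derivable_cst.
exists (normc c) => [|z w _ _]; first exact: normc_ge0.
by rewrite subrr normc0 mulr_ge0 ?normc_ge0.
Qed.

Lemma lipschitz_left_add N N' : lipschitz_left N -> lipschitz_left N' ->
  lipschitz_left (fun z => N z + N' z).
Proof.
move=> [hN [K K0 NK]] [hN' [K' K'0 N'K']]; split.
  by move=> z zl; exact: derivableD (hN z zl) (hN' z zl).
exists (K + K') => [|z w zl wl]; first exact: addr_ge0.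
have [b1 l1] := NK _ _ zl wl; have [b2 l2] := N'K' _ _ zl wl; split.
  by rewrite (le_trans (le_normcD _ _))// lerD.
by rewrite opprD addrACA (le_trans (le_normcD _ _))// mulrDl lerD.
Qed.

Lemma lipschitz_left_mul N N' : lipschitz_left N -> lipschitz_left N' ->
  lipschitz_left (fun z => N z * N' z).
Proof.
move=> [hN [K K0 NK]] [hN' [K' K'0 N'K']]; split.
  by move=> z zl; exact: derivableM (hN z zl) (hN' z zl).
have KK' : 0 <= K * K' by exact: mulr_ge0.
exists (2 * (K * K')) => [|z w zl wl]; first by rewrite mulr_ge0.
have [b1 l1] := NK _ _ zl wl; have [b2 l2] := N'K' _ _ zl wl.
have [b3 _] := NK _ _ wl zl.
split.
  rewrite normcM (@le_trans _ _ (K * K'))//; last lra.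
  by apply: ler_pM; rewrite ?normc_ge0.
rewrite (_ : _ - _ = (N z - N w) * N' z + N w * (N' z - N' w)); last by ring.
rewrite (le_trans (le_normcD _ _))// !normcM mulr_natl mulr2n mulrDl; apply: lerD.
  by rewrite mulrAC; apply: ler_pM; rewrite ?normc_ge0.
by rewrite -mulrA; apply: ler_pM; rewrite ?normc_ge0.
Qed.

Lemma lipschitz_left_inv N (m : R) : lipschitz_left N -> 0 < m ->
  (forall z, complex.Re z <= 2^-1 -> m <= normc (N z)) ->
  lipschitz_left (fun z => (N z)^-1).
Proof.
move=> [hN [K K0 NK]] m0 Nm.
have N0 z : complex.Re z <= 2^-1 -> N z != 0.
  by move=> /Nm; apply: contraTneq => ->; rewrite normc0 -ltNge.
split; first by move=> z zl; apply: derivableV (hN z zl); apply: N0; exact: ltW.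
exists (m^-1 + K * (m^-1 * m^-1)) => [|z w zl wl].
  by rewrite addr_ge0// ?mulr_ge0// ?invr_ge0 ltW.
have im0 : 0 <= m^-1 by rewrite invr_ge0 ltW.
have inv_le x : complex.Re x <= 2^-1 -> normc (N x)^-1 <= m^-1.
  by move=> xl; rewrite normcV lef_pV2 ?posrE ?normc_gt0 ?N0// Nm.
have [_ l] := NK _ _ zl wl; split.
  by rewrite (le_trans (inv_le _ zl))// lerDl !mulr_ge0.
have -> : (N z)^-1 - (N w)^-1 = - (N z - N w) * ((N z)^-1 * (N w)^-1).
  by field; rewrite !N0.
rewrite normcM normcN normcM mulrDl.
apply: (@le_trans _ _ (K * (m^-1 * m^-1) * normc (z - w))); last first.
  by rewrite lerDr mulr_ge0 ?normc_ge0.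
by rewrite mulrAC; apply: ler_pM; rewrite ?mulr_ge0 ?normc_ge0//; apply: ler_pM; rewrite ?normc_ge0 ?inv_le.
Qed.

(** The inner function p^(z - 1/2), with l = log p. *)
Definition inner_exp (l : R) z : C := cexp ((z - 2^-1) * l%:C).

Lemma Re_inner_exp_arg (l : R) z : complex.Re ((z - 2^-1) * l%:C) = (complex.Re z - 2^-1) * l.
Proof.
have -> : (2^-1 : C) = (2^-1)%:C by rewrite fmorphV rmorph_nat.
by case: z => a b; rewrite /= mulr0 subr0.
Qed.

Lemma normc_inner_exp_le1 (l : R) z : 0 <= l -> complex.Re z <= 2^-1 ->
  normc (inner_exp l z) <= 1.
Proof.
move=> l0 zl; rewrite normc_cexp Re_inner_exp_arg expR_le1.
by rewrite mulr_le0_ge0// subr_le0.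
Qed.

Lemma normc_real (l : R) : normc l%:C = `|l|.
Proof. by rewrite /normc/= expr0n addr0 sqrtr_sqr. Qed.

Lemma lipschitz_left_inner_exp (l : R) : 0 <= l -> lipschitz_left (inner_exp l).
Proof.
move=> l0; split=> [z zl|]; last first.
  exists (1 + l) => [|z w zl wl]; first exact: addr_ge0.
  split; first by rewrite (le_trans (normc_inner_exp_le1 l0 zl))// lerDl.
  apply: (le_trans (cexp_lipschitz _ _)).
  - by rewrite Re_inner_exp_arg mulr_le0_ge0// subr_le0.
  - by rewrite Re_inner_exp_arg mulr_le0_ge0// subr_le0.
  rewrite -mulrBl opprB addrA subrK normcM normc_real ger0_norm// mulrC.
  by rewrite ler_wpM2r ?normc_ge0// lerDr.
apply/derivable_normcP; exists (inner_exp l z * l%:C) => e e0.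
set S := normc (inner_exp l z).
pose K := 1 + l + 4 * S * l ^+ 2.
have S0 : 0 <= S by exact: normc_ge0.
have Sl : 0 <= 4 * S * l ^+ 2 by rewrite !mulr_ge0// sqr_ge0.
have K0 : 0 < K by rewrite /K; lra.
exists (Num.min (2^-1 / K) (e / K)) => [|w].
  by rewrite lt_min !divr_gt0.
rewrite le_min => /andP[w1 w2].
(* The second-order remainder is at most 4 S l^2 |w|^2, and r is chosen so that
   |l w| <= 1/2 and 4 S l^2 |w| <= e. *)
have -> : inner_exp l (z + w) - inner_exp l z - inner_exp l z * l%:C * w =
    inner_exp l z * (cexp (w * l%:C) - 1 - w * l%:C).
  have -> : inner_exp l (z + w) = inner_exp l z * cexp (w * l%:C).
    by rewrite /inner_exp -cexpD; congr cexp; ring.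
  ring.
have wl : normc (w * l%:C) <= 2^-1.
  rewrite normcM normc_real ger0_norm//.
  apply: (@le_trans _ _ (2^-1 / K * K)); last by rewrite divfK// gt_eqF.
  by apply: ler_pM; rewrite ?normc_ge0// /K; lra.
rewrite normcM -/S; apply: (@le_trans _ _ (S * (4 * normc (w * l%:C) ^+ 2))).
  by rewrite ler_wpM2l// cexp_taylor.
rewrite normcM normc_real (ger0_norm l0).
rewrite (_ : S * _ = (4 * S * l ^+ 2) * normc w * normc w); last by ring.
rewrite ler_wpM2r ?normc_ge0//.
apply: (@le_trans _ _ (K * (e / K))); last by rewrite mulrC divfK// gt_eqF.
by apply: ler_pM; rewrite ?normc_ge0// /K; lra.
Qed.

End half_plane_functions.

(** * Hardy functions with a denominator vanishing on the critical line *)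

Section cauchy_kernel.
Context {R : realType}.
Local Notation mu := (@lebesgue_measure R).

Lemma continuous_inv1Dsqr : continuous (fun t : R => (1 + t ^+ 2)^-1).
Proof.
move=> t; apply: cvgV; first by rewrite gt_eqF// ltr_pwDl// sqr_ge0.
by apply: cvgD; [exact: cvg_cst|exact: exprn_continuous].
Qed.

Lemma integral_inv1Dsqr : (\int[mu]_t ((1 + t ^+ 2)^-1)%:E = pi%:E :> \bar R)%E.
Proof.
have G0 t : 0 <= (1 + t ^+ 2)^-1 :> R by rewrite invr_ge0 addr_ge0// sqr_ge0.
rewrite ge0_symfun_integralT//; last 2 first.
- exact: continuous_inv1Dsqr.
- by move=> t /=; rewrite sqrrN.
rewrite -set_itvcy (@ge0_continuous_FTC2y _ _ atan 0 (pi / 2)).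
- by rewrite atan0 sube0 -EFinM mulrC divfK.
- by move=> x _.
- exact/continuous_subspaceT/continuous_inv1Dsqr.
- exact: cvgy_atan.
- by move=> x _; exact: derivable_atan.
- by apply: cvg_at_right_filter; exact: continuous_atan.
- by move=> x _; rewrite derive1_atan.
Qed.

Lemma integral_poisson (a d : R) : 0 < d ->
  (\int[mu]_y ((d ^+ 2 + (y - a) ^+ 2)^-1)%:E = (pi / d)%:E)%E.
Proof.
move=> d0; have id0 : 0 < d^-1 by rewrite invr_gt0.
pose G (t : R) : R := (1 + t ^+ 2)^-1.
have G0 t : 0 <= G t by rewrite invr_ge0 addr_ge0// sqr_ge0.
pose F (y : R) := (y - a) * d^-1.
have dF (y : R) : derivable F y 1 by apply: derivableM.
have F'E : F^`()%classic = cst d^-1.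
  apply/funext => x; rewrite /F derive1E deriveM// deriveD// derive_cst scaler0.
  by rewrite add0r derive_id derive_cst addr0 scaler1.
have Fincr : {homo F : x y / x < y} by move=> x y xy; rewrite /F ltr_pM2r// ltrD2r.
have cF' : continuous F^`()%classic by rewrite F'E => ?; exact: cvg_cst.
have F'cvg (B : set_system R) : Filter B -> cvg (F^`()%classic x @[x --> B]).
  by move=> ?; rewrite F'E; exact: is_cvg_cst.
have FNy : F x @[x --> -oo] --> -oo by apply/gt0_cvgMlNy; last exact: cvg_addrr_Ny.
have Fy : F x @[x --> +oo] --> +oo by apply/gt0_cvgMly; last exact: cvg_addrr.
have FG := increasing_ge0_integration_by_substitutionT Fincr cF' (F'cvg _ _)
  (F'cvg _ _) dF FNy Fy continuous_inv1Dsqr G0.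
rewrite integral_inv1Dsqr in FG.
rewrite EFinM FG muleC -ge0_integralZl//=.
- apply: eq_integral => y _; rewrite F'E -EFinM /G /F/=; congr EFin.
  rewrite [RHS](_ : _ = d^-1 * ((1 + ((y - a) * d^-1) ^+ 2)^-1 * d^-1))//.
  rewrite exprMn exprVn; set t := (y - a) ^+ 2.
  have t0 : 0 <= t by exact: sqr_ge0.
  by field; rewrite !gt_eqF ?ltr_pwDl ?exprn_gt0.
- apply/measurable_EFinP; rewrite F'E; apply: measurable_funM => //.
  apply: measurableT_comp; first exact: continuous_measurable_fun continuous_inv1Dsqr.
  by apply: measurable_funM => //; exact: measurable_funB.
- by move=> y _; rewrite lee_fin F'E; apply: mulr_ge0; [exact: G0|exact: ltW].
- by rewrite lee_fin ltW.
Qed.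

Lemma energy_le_poisson (f : R -> R[i]) (A d a : R) : cmeasurable f -> 0 <= A -> 0 < d ->
  (forall y, normc (f y) ^+ 2 <= A * (d ^+ 2 + (y - a) ^+ 2)^-1) ->
  (energy f <= (A * (pi / d))%:E)%E.
Proof.
move=> mf A0 d0 fA.
have D0 (y : R) : 0 < d ^+ 2 + (y - a) ^+ 2 by rewrite ltr_pwDl ?exprn_gt0 ?sqr_ge0.
have mP : measurable_fun setT (fun y : R => (d ^+ 2 + (y - a) ^+ 2)^-1).
  apply: continuous_measurable_fun => y; apply: cvgV; first by rewrite gt_eqF.
  apply: cvgD; first exact: cvg_cst.
  apply: (@continuous_comp _ _ _ (fun y => y - a) (fun x => x ^+ 2)).
    by apply: cvgB; [exact: cvg_id|exact: cvg_cst].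
  exact: exprn_continuous.
rewrite EFinM -(integral_poisson a d0) -ge0_integralZl//.
- apply: ge0_le_integral => //.
  + by move=> y _; rewrite lee_fin sqr_ge0.
  + by apply/measurable_EFinP; exact: measurable_sqr_normc.
  + by apply/measurable_EFinP; exact: measurable_funM.
  + by move=> y _; rewrite -EFinM lee_fin.
- exact/measurable_EFinP.
- by move=> y _; rewrite lee_fin invr_ge0 ltW.
Qed.

End cauchy_kernel.

Section quotients.
Context {R : realType}.
Local Notation C := R[i].
Local Notation mu := (@lebesgue_measure R).

Lemma measurable_invr : measurable_fun setT (fun x : R => x^-1).
Proof.
rewrite -(setUv [set 0 : R]).
apply/measurable_funU => //; first exact: measurableC.
split; first exact: measurable_fun_set1.
apply: open_continuous_measurable_fun; first exact/closed_openC/closed_eq.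
move=> x; rewrite inE/= => x0; apply: cvgV; last exact: cvg_id.
exact/eqP.
Qed.

(** When N is Lipschitz and vanishes at crit a the quotient stays bounded; at
    crit a itself the division convention gives the value 0. *)
Definition quotient_at (a : R) (N : C -> C) (z : C) : C := N z / (z - crit a).

Variables (N : C -> C) (a K : R).
Hypotheses (hN : holomorphic_left N) (K0 : 0 <= K) (Na : N (crit a) = 0).
Hypothesis NK : forall z w, complex.Re z <= 2^-1 -> complex.Re w <= 2^-1 ->
    normc (N z) <= K /\ normc (N z - N w) <= K * normc (z - w).

Let H := quotient_at a N.

Lemma sqr_normc_sub_crit (x y : R) :
  normc ((x +i* y) - crit a) ^+ 2 = (2^-1 - x) ^+ 2 + (y - a) ^+ 2.
Proof. by rewrite sqr_normcE /=; ring. Qed.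

(** The Lipschitz bound controls the quotient near crit a, the bound on N
    controls it at infinity. *)
Lemma quotient_le z : complex.Re z <= 2^-1 ->
  normc (H z) <= K /\ normc (H z) * normc (z - crit a) <= K.
Proof.
move=> zl; have [zc|zc] := eqVneq z (crit a).
  by rewrite /H /quotient_at zc subrr invr0 mulr0 normc0 mul0r.
have d0 : 0 < normc (z - crit a) by rewrite normc_gt0// subr_eq0.
have [b l] := NK zl (lexx _ : complex.Re (crit a) <= 2^-1).
rewrite Na subr0 in l.
rewrite /H /quotient_at normcM normcV; split; first by rewrite ler_pdivrMr.
by rewrite divfK// gt_eqF.
Qed.

Lemma holomorphic_left_quotient : holomorphic_left H.
Proof.
move=> z zl; apply: (derivableM (hN zl)).
have zc : z - crit a != 0.
  by rewrite subr_eq0; apply: contraTneq zl => ->; rewrite /= ltxx.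
apply: (@derivableV _ _ (fun z : C^o => z - crit a : C^o) z 1 zc).
apply/derivable_normcP; exists 1 => e e0; exists 1 => // w _.
rewrite (_ : _ - 1 * w = 0); last by ring.
by rewrite normc0 mulr_ge0 ?normc_ge0// ltW.
Qed.

Lemma cmeasurable_quotient_crit : cmeasurable (H \o crit).
Proof.
apply: cmeasurable_mul.
- have cN (e : R) (y : R) : 0 < e -> \forall t \near y, normc (N (crit y) - N (crit t)) <= e.
    move=> e0; apply/nbhs_ballP; exists (e / (K + 1)) => /=.
      by rewrite divr_gt0// ltr_wpDl.
    move=> t; rewrite /ball/= => yt.
    have [_ l] := NK (lexx _ : complex.Re (crit y) <= 2^-1) (lexx _ : complex.Re (crit t) <= 2^-1).
    apply: (le_trans l).
    have -> : crit y - crit t = 0 +i* (y - t) by rewrite /crit; simpc; rewrite ?subrr.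
    rewrite {1}/normc/= expr0n/= add0r sqrtr_sqr.
    apply: (@le_trans _ _ ((K + 1) * (e / (K + 1)))); last first.
      by rewrite mulrC divfK// gt_eqF// ltr_wpDl.
    by apply: ler_pM => //; [rewrite lerDl|exact: ltW].
  split; apply: continuous_measurable_fun => y; apply/cvgrPdist_le => e e0;
    apply: filterS (cN e y e0) => t; apply: le_trans.
  + apply: le_trans (Re_le_normc _); rewrite le_eqVlt; apply/orP; left.
    by case: (N _) (N _) => [? ?] [? ?].
  + apply: le_trans (Im_le_normc _); rewrite le_eqVlt; apply/orP; left.
    by case: (N _) (N _) => [? ?] [? ?].
- have E y : (crit y - crit a)^-1 = 0 +i* (- (y - a)^-1).
    have -> : crit y - crit a = 0 +i* (y - a) by rewrite /crit; simpc; rewrite ?subrr.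
    have [->|ya] := eqVneq (y - a) 0.
      by rewrite -[0 +i* 0]/(0 : C) !invr0 oppr0.
    apply: (mulfI (_ : 0 +i* (y - a) != 0)).
      by apply: contra_neq ya => -[].
    rewrite mulfV; last by apply: contra_neq ya => -[].
    by simpc; rewrite divff.
  split.
  + by under eq_fun do rewrite E /=; exact: measurable_cst.
  + under eq_fun do rewrite E /=.
    apply: measurableT_comp => //; apply: (measurableT_comp measurable_invr).
    exact: measurable_funB.
Qed.

Lemma cmeasurable_quotient (x : R) : x <= 2^-1 -> cmeasurable (fun y => H (x +i* y)).
Proof.
rewrite le_eqVlt => /predU1P[->|xl]; first exact: cmeasurable_quotient_crit.
exact: holomorphic_left_cmeasurable holomorphic_left_quotient xl.
Qed.

Lemma energy_quotient_le (x : R) : x < 2^-1 ->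
  (energy (fun y => H (x +i* y)) <= (K ^+ 2 * (pi / (2^-1 - x)))%:E)%E.
Proof.
move=> xl; apply: (@energy_le_poisson _ _ _ _ a).
- exact/cmeasurable_quotient/ltW.
- exact: sqr_ge0.
- by rewrite subr_gt0.
move=> y; rewrite -sqr_normc_sub_crit ler_pdivlMr; last first.
  by rewrite sqr_normc_sub_crit ltr_pwDl ?sqr_ge0// exprn_gt0// subr_gt0.
have [_ h] := quotient_le (ltW xl : complex.Re (x +i* y) <= 2^-1).
by rewrite -exprMn ler_sqr ?nnegrE ?mulr_ge0 ?normc_ge0.
Qed.

Lemma sqr_quotient_le (x y : R) : x <= 2^-1 ->
  normc (H (x +i* y)) ^+ 2 <= 2 * K ^+ 2 * (1 ^+ 2 + (y - a) ^+ 2)^-1.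
Proof.
move=> xl; rewrite ler_pdivlMr; last by rewrite ltr_pwDl ?exprn_gt0 ?sqr_ge0.
have [h1 h2] := quotient_le (xl : complex.Re (x +i* y) <= 2^-1).
have {}h1 : normc (H (x +i* y)) ^+ 2 <= K ^+ 2 by rewrite ler_sqr ?nnegrE ?normc_ge0.
have {}h2 : (normc (H (x +i* y)) * normc (x +i* y - crit a)) ^+ 2 <= K ^+ 2.
  by rewrite ler_sqr ?nnegrE ?mulr_ge0 ?normc_ge0.
rewrite exprMn sqr_normc_sub_crit in h2.
have := mulr_ge0 (sqr_ge0 (normc (H (x +i* y)))) (sqr_ge0 (2^-1 - x)).
by rewrite expr1n; lra.
Qed.

Lemma energy_quotient_bounded (x : R) : x <= 2^-1 ->
  (energy (fun y => H (x +i* y)) <= (2 * K ^+ 2 * pi)%:E)%E.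
Proof.
move=> xl; rewrite -[X in (_ * X)%:E]divr1; apply: (@energy_le_poisson _ _ _ _ a) => //.
- exact: cmeasurable_quotient.
- by rewrite mulr_ge0// sqr_ge0.
- by move=> y; exact: sqr_quotient_le.
Qed.

(** Replacing z by its projection z' to the line costs |N z - N z'| in the
    numerator and |H z'| |z - z'| in the denominator, both at most
    K (1/2 - x). *)
Lemma quotient_sub_crit_le (x y : R) : x < 2^-1 ->
  normc (H (x +i* y) - H (crit y)) * normc (x +i* y - crit a) <= 2 * K * (2^-1 - x).
Proof.
move=> xl; set z := x +i* y; set z' := crit y.
have d0 : 0 < 2^-1 - x by rewrite subr_gt0.
have zz' : normc (z - z') = 2^-1 - x.
  have -> : z - z' = (x - 2^-1) +i* 0 by rewrite /z /z' /crit; simpc; rewrite ?subrr.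
  by rewrite /normc expr0n addr0 sqrtr_sqr distrC ger0_norm// ltW.
have zl : complex.Re z <= 2^-1 by exact: ltW.
have z'l : complex.Re z' <= 2^-1 by exact: lexx.
have zc : z - crit a != 0.
  by rewrite subr_eq0; apply: contraTneq xl => -[->]; rewrite ltxx.
have [ya|ya] := eqVneq y a.
  have -> : H z' = 0 by rewrite /H /quotient_at /z' ya subrr invr0 mulr0.
  have zz'a : normc (z - crit a) = 2^-1 - x by rewrite -ya zz'.
  rewrite subr0 zz'a ler_pM2r//; apply: (le_trans (quotient_le zl).1).
  by rewrite mulr_natl mulr2n lerDl.
have z'c : z' - crit a != 0.
  by rewrite subr_eq0; apply: contra_neq ya => -[].
rewrite -normcM.
have -> : (H z - H z') * (z - crit a) = (N z - N z') - H z' * (z - z').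
  by rewrite /H /quotient_at; field; rewrite zc z'c.
apply: (le_trans (normc_leB _ _)); rewrite -mulrA mulr_natl mulr2n; apply: lerD.
  by have [_] := NK zl z'l; rewrite zz'.
rewrite normcM zz' ler_pM2r//.
by have [] := quotient_le z'l.
Qed.

Lemma boundary_value_quotient : boundary_value H (H \o crit).
Proof.
apply/norm2_cvg0P => e e0.
pose A := 4 * K ^+ 2 * pi + 1.
have A0 : 0 < A by rewrite ltr_wpDl// !mulr_ge0 ?sqr_ge0 ?pi_ge0.
have d0 : 0 < e / A by rewrite divr_gt0.
near=> x.
have xl : x < 2^-1 by near: x; exact: nbhs_left_lt.
have xe : 2^-1 - x < e / A by near: x; exact: nbhs_left_ltBl.
have dx : 0 < 2^-1 - x by rewrite subr_gt0.
apply: (@le_trans _ _ ((2 * K * (2^-1 - x)) ^+ 2 * (pi / (2^-1 - x)))%:E).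
  apply: (@energy_le_poisson _ _ _ _ a) => //.
  - by apply: cmeasurable_sub; [exact/cmeasurable_quotient/ltW|exact: cmeasurable_quotient_crit].
  - exact: sqr_ge0.
  move=> y; rewrite -sqr_normc_sub_crit ler_pdivlMr; last first.
    by rewrite sqr_normc_sub_crit ltr_pwDl ?sqr_ge0// exprn_gt0.
  rewrite -exprMn; apply: lerXn2r; last exact: quotient_sub_crit_le.
    by rewrite nnegrE mulr_ge0 ?normc_ge0.
  by rewrite nnegrE; apply: mulr_ge0; [exact: mulr_ge0|exact: ltW].
rewrite lee_fin (_ : _ * _ = 4 * K ^+ 2 * pi * (2^-1 - x)); last first.
  by move: (2^-1 - x) dx => t t0; field; rewrite gt_eqF.
apply: (@le_trans _ _ (A * (e / A))); last by rewrite mulrC divfK// gt_eqF.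
by apply: ler_pM => //; [rewrite !mulr_ge0 ?sqr_ge0 ?pi_ge0|exact: ltW|rewrite lerDl|exact: ltW].
Unshelve. all: end_near. Qed.

Lemma L2_quotient : L2 (H \o crit).
Proof.
apply/L2P; split; first exact: cmeasurable_quotient_crit.
by exists (2 * K ^+ 2 * pi); exact: energy_quotient_bounded.
Qed.

Lemma hardy_bounded_quotient : hardy_bounded H.
Proof. by exists (2 * K ^+ 2 * pi) => x /ltW xl; exact: energy_quotient_bounded. Qed.

Lemma H2_quotient : H2 (H \o crit).
Proof.
split; first exact: L2_quotient.
exists H; split; [exact: holomorphic_left_quotient|exact: hardy_bounded_quotient|].
exact: boundary_value_quotient.
Qed.

(** By energy_quotient_le the quotients die out far to the left, so they can
    serve as test functions in the pairing. *)
Lemma H2_pairing_quotient g : H2 g ->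
  \int[mu]_y complex.Re (g y * H (crit y)) = 0.
Proof.
move=> [g2 [F [hF bF Fg]]].
apply: (hardy_pairing g2 L2_quotient hF bF Fg holomorphic_left_quotient
  hardy_bounded_quotient boundary_value_quotient) => e e0.
pose A := K ^+ 2 * pi + 1.
have A0 : 0 < A by rewrite ltr_wpDl// mulr_ge0 ?sqr_ge0 ?pi_ge0.
have x0 : 2^-1 - A / e < 2^-1 by rewrite gtrBl divr_gt0.
exists (2^-1 - A / e) => //; apply: (le_trans (energy_quotient_le x0)).
rewrite opprB addrC subrK lee_fin mulrA ler_pdivrMr ?divr_gt0//.
by rewrite (mulrC e) divfK ?gt_eqF// lerDl.
Qed.

End quotients.

(** * Weak convergence *)

Section weak_convergence.
Context {R : realType}.
Local Notation C := R[i].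
Local Notation mu := (@lebesgue_measure R).
Implicit Types (f g h : R -> C).

(** A bounded sequence of L^2 that tends to 0 pointwise tends weakly to 0:
    |g k_n| is at most d |k_n|^2 plus the minimum of |g k_n| and |g|^2 / d, to
    which dominated convergence applies. *)
Lemma weak_cvg0 g (k : nat -> R -> C) (B : R) : L2 g -> (forall n, L2 (k n)) ->
  (forall n, (energy (k n) <= B%:E)%E) ->
  (forall y, normc (k n y) @[n --> \oo] --> (0 : R)) ->
  forall e : R, 0 < e -> exists N : nat, forall n, (N <= n)%N ->
    `|\int[mu]_y complex.Re (g y * k n y)| <= e.
Proof.
move=> g2 k2 kB kcvg e e0.
have B0 : 0 <= B by rewrite -lee_fin; exact: le_trans (energy_ge0 _) (kB 0%N).
have /L2P[mg [A gA]] := g2.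
have mk n : cmeasurable (k n) by have /L2P[] := k2 n.
pose d := e / (2 * (B + 1)).
have d0 : 0 < d by rewrite divr_gt0// mulr_gt0// ltr_wpDl.
pose G y := d^-1 * normc (g y) ^+ 2.
have G0 y : 0 <= G y by rewrite mulr_ge0 ?sqr_ge0// invr_ge0 ltW.
have mG : measurable_fun setT G.
  by apply: measurable_funM => //; exact: measurable_sqr_normc.
have Gi : mu.-integrable setT (EFin \o G).
  apply/integrableP; split; first exact/measurable_EFinP.
  under eq_integral do rewrite /= ger0_norm ?G0// /G EFinM.
  rewrite ge0_integralZl//.
  - by apply: lte_mul_pinfty => //; [rewrite lee_fin invr_ge0 ltW|exact: le_lt_trans gA (ltry _)].
  - by apply/measurable_EFinP; exact: measurable_sqr_normc.
  - by move=> y _; rewrite lee_fin sqr_ge0.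
  - by rewrite lee_fin invr_ge0 ltW.
pose m n y := Num.min (normc (g y * k n y)) (G y).
have m0 n y : 0 <= m n y by rewrite le_min normc_ge0 G0.
have mm n : measurable_fun setT (m n).
  apply: measurable_minr => //.
  exact: (measurable_normc (cmeasurable_mul mg (mk n))).
have mcvg : (\int[mu]_y (m n y)%:E)%E @[n --> \oo] --> (\int[mu]_y (cst 0 y : \bar R))%E.
  apply: (@dominated_cvg _ _ _ mu setT measurableT (fun n => EFin \o m n) (cst 0%E) (EFin \o G)) => //.
  - by move=> n; apply/measurable_EFinP; exact: mm.
  - move=> y _; apply: cvg_EFin; first by near=> n.
    apply: (@squeeze_cvgr _ _ _ _ (cst 0) (fun n => normc (g y) * normc (k n y))).
    + by near=> n; rewrite m0 /= -normcM ge_min lexx.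
    + exact: cvg_cst.
    + rewrite -[X in _ --> X](mulr0 (normc (g y))).
      by apply: cvgM; [exact: cvg_cst|exact: kcvg].
  - by move=> n y _ /=; rewrite lee_fin ger0_norm// ge_min lexx orbT.
rewrite integral0 in mcvg.
have mge0 n : (0 <= \int[mu]_y (m n y)%:E)%E.
  by apply: integral_ge0 => y _; rewrite lee_fin.
have e20 : 0 < e / 2 by rewrite divr_gt0.
have [N _ NP] := (cvge0_leP mge0).1 mcvg _ e20.
exists N => n Nn; have {NP} mn := NP n Nn.
have [ri _] := L2_mul_integrable g2 (k2 n).
rewrite -lee_fin EFin_normr_Rintegral//.
apply: (le_trans (le_abse_integral _ _ _)) => //; first exact: measurable_int ri.
apply: (@le_trans _ _ (\int[mu]_y ((d * normc (k n y) ^+ 2)%:E + (m n y)%:E)%E)%E).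
  apply: ge0_le_integral => //.
  - by apply: measurableT_comp => //; exact: measurable_int ri.
  - apply: emeasurable_funD; apply/measurable_EFinP; last exact: mm.
    by apply: measurable_funM => //; exact: measurable_sqr_normc.
  - move=> y _; rewrite -EFinD lee_fin.
    apply: (le_trans (Re_le_normc _)); rewrite /m /Order.min.
    case: ifPn => [_|]; first by rewrite lerDr mulr_ge0 ?sqr_ge0// ltW.
    move=> _; rewrite (mulrC (g y)); exact: young_normc.
rewrite ge0_integralD//; first last.
- by apply/measurable_EFinP; exact: mm.
- by move=> y _; rewrite lee_fin.
- by apply/measurable_EFinP; apply: measurable_funM => //; exact: measurable_sqr_normc.
- by move=> y _; rewrite lee_fin mulr_ge0 ?sqr_ge0// ltW.
under eq_integral do rewrite EFinM.
rewrite ge0_integralZl//; first last.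
- by rewrite lee_fin ltW.
- by move=> y _; rewrite lee_fin sqr_ge0.
- by apply/measurable_EFinP; exact: measurable_sqr_normc.
apply: (@le_trans _ _ ((d * B)%:E + (e / 2)%:E)%E).
  by apply: leeD; [rewrite (EFinM d B) lee_pmul2l//; exact: kB|exact: mn].
rewrite -EFinD lee_fin.
have : d * B <= e / 2.
  apply: (@le_trans _ _ (d * (B + 1))); first by rewrite ler_pM2l// lerDl.
  by rewrite /d le_eqVlt; apply/orP; left; apply/eqP; field; rewrite gt_eqF// ltr_wpDl.
lra.
Unshelve. all: end_near. Qed.

End weak_convergence.

(** * Hankel operators tested against Hardy functions *)

Section hardy_projection.
Context {R : realType}.
Local Notation C := R[i].
Local Notation mu := (@lebesgue_measure R).
Implicit Types (f g h : R -> C) (u : C -> C).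

Lemma hardy_proj_cases f : is_hardy_proj f (hardy_proj f) \/ hardy_proj f = (fun=> 0).
Proof.
have [[g gP]|nop] := pselect (exists g, is_hardy_proj f g).
  by left; apply: (xgetPex _ (ex_intro _ g gP)).
by right; apply: xgetPN => g gP; apply: nop; exists g.
Qed.

Lemma energy_Rintegral f : L2 f ->
  (\int[mu]_y complex.Re (f y * conjc (f y)))%:E = energy f.
Proof.
move=> f2; rewrite /energy /Rintegral.
have E y : (complex.Re (f y * conjc (f y)))%:E = (normc (f y) ^+ 2)%:E.
  by rewrite sqr_normcE; case: (f y) => a b /=; congr EFin; ring.
under eq_integral do rewrite E.
rewrite fineK// ge0_fin_numE; last exact: energy_ge0.
by have /L2P[_ [A fA]] := f2; exact: le_lt_trans fA (ltry _).
Qed.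

(** A Hardy function is one of its own projections; another one p satisfies
    <f - p, f> = <f - p, p> = 0, hence ||f - p|| = 0. *)
Lemma hardy_proj_id f : H2 f ->
  is_hardy_proj f (hardy_proj f) /\ energy (hardy_proj f \- f) = 0%E.
Proof.
move=> Hf; have f2 := Hf.1.
have ff : is_hardy_proj f f.
  split=> // h _; rewrite /inner.
  have E y : (f \- f) y * conjc (h y) = 0 by rewrite /= subrr mul0r.
  under eq_Rintegral do rewrite E.
  rewrite [X in _ +i* X](_ : _ = 0) ?[X in X +i* _](_ : _ = 0)//.
    by rewrite /Rintegral integral0.
  by under eq_Rintegral do rewrite E; rewrite /Rintegral integral0.
have pP : is_hardy_proj f (hardy_proj f) by exact: (xgetPex _ (ex_intro _ f ff)).
split=> //; set p := hardy_proj f in pP *.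
have [Hp pperp] := pP; have p2 := Hp.1.
have pf2 := L2_sub p2 f2; have fp2 := L2_sub f2 p2.
have Re0 h : H2 h -> \int[mu]_y complex.Re ((f \- p) y * conjc (h y)) = 0.
  by move=> /pperp; rewrite /inner => -[].
have [i1 _] := L2_mul_integrable fp2 (L2_conj p2).
have [i2 _] := L2_mul_integrable fp2 (L2_conj f2).
rewrite -energy_Rintegral//; congr EFin.
transitivity (\int[mu]_y (complex.Re ((f \- p) y * conjc (f y)) - complex.Re ((f \- p) y * conjc (p y)))).
  apply: eq_Rintegral => y _ /=.
  by case: (p y) (f y) => [? ?] [? ?] /=; ring.
by rewrite RintegralB// Re0// Re0// subrr.
Qed.

Lemma mulop_L2 u f (A : R) : cmeasurable (u \o crit) ->
  (forall y, normc (u (crit y)) = 1) -> L2 f -> (energy f <= A%:E)%E ->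
  L2 (mulop u f) /\ (energy (mulop u f) <= A%:E)%E.
Proof.
move=> mu1 u1 f2 fA.
have E : energy (mulop u f) = energy f.
  by apply: eq_integral => y _; rewrite /mulop normcM u1 mul1r.
rewrite E; split=> //; apply/L2P; split; last by exists A; rewrite E.
by apply: cmeasurable_mul => //; have /L2P[] := f2.
Qed.

(** The function subtracted in the Hankel operator is in H2 or is the default
    value 0 of the projection, so it pairs to 0 with k: the pairing sees only
    the symbol. *)
Lemma hankel_pairing u f k : cmeasurable (u \o crit) ->
  (forall y, normc (u (crit y)) = 1) -> H2 f -> L2 k ->
  (forall g, H2 g -> \int[mu]_y complex.Re (g y * k y) = 0) ->
  L2 (hankel u f) /\
  \int[mu]_y complex.Re (hankel u f y * k y) =
  \int[mu]_y complex.Re (u (crit y) * f y * k y).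
Proof.
move=> um u1 Hf k2 kperp; have f2 := Hf.1.
have [[Hp _] pf0] := hardy_proj_id Hf; have p2 := Hp.1.
set p := hardy_proj f in Hp pf0 p2.
have /L2P[_ [A pA]] := p2; have /L2P[_ [B fB]] := f2.
have /L2P[_ [D kD]] := k2.
have pf2 := L2_sub p2 f2.
have [v2 _] := mulop_L2 um u1 p2 pA; have [w2 _] := mulop_L2 um u1 f2 fB.
have pf0' : (energy (p \- f)%R <= 0%:E)%E by rewrite pf0.
have [z2 z0] := mulop_L2 um u1 pf2 pf0'.
have D0 : 0 <= D by rewrite -lee_fin; exact: le_trans (energy_ge0 _) kD.
pose r := hardy_proj (mulop u p).
have [r2 rk] : L2 r /\ \int[mu]_y complex.Re (r y * k y) = 0.
  rewrite /r; case: (hardy_proj_cases (mulop u p)) => [[Hr _]|->].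
    by split; [exact: Hr.1|exact: kperp].
  split.
    have := L2_sub f2 f2; congr L2; apply/funext => y /=; exact: subrr.
  by under eq_Rintegral do rewrite mul0r; rewrite /Rintegral integral0.
have hE : hankel u f = mulop u p \- r by [].
split; first by rewrite hE; exact: L2_sub.
have [iv _] := L2_mul_integrable v2 k2.
have [iw _] := L2_mul_integrable w2 k2.
have [iz _] := L2_mul_integrable z2 k2.
have [ir _] := L2_mul_integrable r2 k2.
have -> : \int[mu]_y complex.Re (hankel u f y * k y) =
    \int[mu]_y (complex.Re (mulop u p y * k y) - complex.Re (r y * k y)).
  apply: eq_Rintegral => y _; rewrite hE /=.
  by case: (mulop u p y) (r y) (k y) => [? ?] [? ?] [? ?] /=; ring.
rewrite RintegralB// rk subr0.
have zk : \int[mu]_y complex.Re (mulop u (p \- f) y * k y) = 0.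
  apply/eqP; rewrite -normr_le0; apply/ler_addgt0Pr => e e0; rewrite add0r.
  (* The energy of u (p - f) is 0, so the weight t can be taken so large that
     the contribution of k is at most e. *)
  pose t := (D + 1) / e.
  have t0 : 0 < t by rewrite divr_gt0// ltr_wpDl.
  apply: (le_trans (Rintegral_Re_mul_le z2 k2 z0 kD t0)).
  rewrite mulr0 add0r /t invf_div mulrAC ler_pdivrMr ?ltr_wpDl//.
  by rewrite ler_pM2l// lerDl.
apply/eqP; rewrite -subr_eq0 -(RintegralB _ iv iw)//; apply/eqP.
rewrite -[RHS]zk; apply: eq_Rintegral => y _; rewrite /mulop /=.
by case: (u (crit y)) (p y) (f y) (k y) => [? ?] [? ?] [? ?] [? ?] /=; ring.
Qed.

End hardy_projection.

(** * The explicit sequences *)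

Section explicit_functions.
Context {R : realType}.
Local Notation C := R[i].
Local Notation mu := (@lebesgue_measure R).
Variable l : R.
Hypothesis l0 : 0 < l.

Let q : R := expR (- 2^-1 * l).
Let s (z : C) : C := inner_exp l z.
Let u (z : C) : C := 1 - q%:C * s z.

Let q0 : 0 < q. Proof. exact: expR_gt0. Qed.
Let q1 : q < 1.
Proof. by rewrite expR_lt1 mulNr oppr_lt0 mulr_gt0// invr_gt0. Qed.

Let u_ge z : complex.Re z <= 2^-1 -> 1 - q <= normc (u z).
Proof.
move=> zl; have : normc (1 : C) <= normc (u z) + normc (q%:C * s z).
  by rewrite -[X in normc X](subrK (q%:C * s z)); exact: le_normcD.
rewrite normc1 normcM normc_real gtr0_norm// => h.
have : q * normc (s z) <= q by rewrite ler_piMr ?(ltW q0)// normc_inner_exp_le1// ltW.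
lra.
Qed.

Lemma symbol_den_neq0 z : complex.Re z <= 2^-1 -> u z != 0.
Proof.
by move=> /u_ge; apply: contraTneq => ->; rewrite normc0 -ltNge subr_gt0.
Qed.

(** Divided by z - crit a, with a a multiple of the period 2 pi / l of s along
    the line, these are the functions f, h and k of the proof. *)
Definition source_num (z : C) : C := (s z - 1) * (u z)^-1.
Definition fejer_num (z : C) : C := s z - 1.
Definition test_num (z : C) : C := (s z - 1) * (1 + (q ^+ 2)%:C * (u z)^-1).

Lemma lipschitz_left_fejer_num : lipschitz_left fejer_num.
Proof.
apply: lipschitz_left_add; last exact: lipschitz_left_cst.
exact/lipschitz_left_inner_exp/ltW.
Qed.

Let lipschitz_left_invu : lipschitz_left (fun z => (u z)^-1).
Proof.
apply: (@lipschitz_left_inv _ _ (1 - q)); [|by rewrite subr_gt0|exact: u_ge].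
rewrite (_ : u = fun z => 1 + (- q)%:C * s z); last first.
  by apply/funext => z; rewrite /u rmorphN mulNr.
apply: lipschitz_left_add; first exact: lipschitz_left_cst.
apply: lipschitz_left_mul; first exact: lipschitz_left_cst.
exact/lipschitz_left_inner_exp/ltW.
Qed.

Lemma lipschitz_left_source_num : lipschitz_left source_num.
Proof. exact: lipschitz_left_mul lipschitz_left_fejer_num lipschitz_left_invu. Qed.

Lemma lipschitz_left_test_num : lipschitz_left test_num.
Proof.
apply: lipschitz_left_mul lipschitz_left_fejer_num _.
apply: lipschitz_left_add; first exact: lipschitz_left_cst.
by apply: lipschitz_left_mul lipschitz_left_invu; exact: lipschitz_left_cst.
Qed.

(** The heights at which s = 1 on the critical line. *)
Definition period_point (n : nat) : R := pi *+ 2 *+ n / l.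

Lemma inner_exp_crit (y : R) : s (crit y) = cos (y * l) +i* sin (y * l).
Proof.
rewrite /s /inner_exp /crit.
have -> : (2^-1 : C) = (2^-1)%:C by rewrite fmorphV rmorph_nat.
have -> : (2^-1 +i* y - (2^-1)%:C) * l%:C = 0 +i* (y * l).
  by simpc; rewrite ?subrr ?mul0r.
by rewrite /cexp /= expR0; simpc.
Qed.

Lemma period_pointM n : period_point n * l = pi *+ 2 *+ n.
Proof. by rewrite divfK// gt_eqF. Qed.

Lemma inner_exp_period_point n : s (crit (period_point n)) = 1.
Proof.
rewrite inner_exp_crit period_pointM -[_ *+ n]add0r.
by rewrite (periodicn (@cosD2pi R)) (periodicn (@sinD2pi R)) cos0 sin0.
Qed.

Lemma source_num_period_point n : source_num (crit (period_point n)) = 0.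
Proof. by rewrite /source_num inner_exp_period_point subrr mul0r. Qed.

Lemma fejer_num_period_point n : fejer_num (crit (period_point n)) = 0.
Proof. by rewrite /fejer_num inner_exp_period_point subrr. Qed.

Lemma test_num_period_point n : test_num (crit (period_point n)) = 0.
Proof. by rewrite /test_num inner_exp_period_point subrr mul0r. Qed.

Let S (y : R) : C := cos (y * l) +i* sin (y * l).

Let S_neq0 y : S y != 0.
Proof.
apply/eqP => -[c0 s0]; have := cos2Dsin2 (y * l).
by rewrite c0 s0 expr0n/= addr0 => /eqP; rewrite eq_sym oner_eq0.
Qed.

Let S_conj y : conjc (S y) = (S y)^-1.
Proof.
apply: (mulfI (S_neq0 y)); rewrite mulfV// /S; simpc.
have := cos2Dsin2 (y * l); rewrite !expr2 => ->.
by congr (_ +i* _); ring.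
Qed.

(** The identity behind the choice of the numerators. On the line s^* = 1/s
    and (z - crit a)^* = - (z - crit a), so both sides are (s - 1)^2 over
    (z - crit a)^2 times a rational function of s: u + q^2 = 1 + q^2 - q s
    equals u u^* + q / s. *)
Lemma rho_product_id (y a : R) :
  let c := crit y in
  u c / conjc (u c) * quotient_at a source_num c * quotient_at a test_num c =
  quotient_at a fejer_num c * quotient_at a fejer_num c
    + (q * normc (quotient_at a source_num c) ^+ 2)%:C.
Proof.
move=> c; have cl : complex.Re c <= 2^-1 by exact: lexx.
have u1 := symbol_den_neq0 cl; have u2 : conjc (u c) != 0 by rewrite conjc_eq0.
rewrite (_ : (q * _)%:C = q%:C * (quotient_at a source_num c *
    conjc (quotient_at a source_num c))); last first.
  by rewrite -sqr_normc norm_normc rmorphM rmorphXn.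
rewrite /quotient_at /source_num /test_num /fejer_num.
set d := c - crit a.
have dE : conjc d = - d.
  by rewrite /d /c /crit; simpc; rewrite ?subrr ?oppr0.
have sE : s c = S y by rewrite inner_exp_crit.
have conj1 : conjc (1 : C) = 1 by exact: rmorph1.
have conjB (z w : C) : conjc (z - w) = conjc z - conjc w by exact: rmorphB.
have conjM (z w : C) : conjc (z * w) = conjc z * conjc w by exact: rmorphM.
have conjV (z : C) : conjc z^-1 = (conjc z)^-1 by exact: fmorphV.
have uE : conjc (u c) = 1 - q%:C / S y.
  by rewrite /u sE conjB conjM conj1 S_conj conjc_real.
rewrite !conjM !conjV dE uE conjB conj1 sE S_conj.
rewrite uE in u2; rewrite /u sE in u1 *.
have [d0|d0] := eqVneq d 0; first by rewrite d0 oppr0 invr0 !mulr0 addr0.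
have S0 := S_neq0 y; move: (S y) S0 u1 u2 d0 => T T0 u1 u2 d0.
have u3 : T - q%:C != 0.
  by apply: contra_neq u2 => /eqP; rewrite subr_eq0 => /eqP <-; rewrite divff// subrr.
by rewrite rmorphXn /=; field; rewrite T0 u1 u3 d0.
Qed.

Let pil0 : 0 < pi / l. Proof. by rewrite divr_gt0// pi_gt0. Qed.

(** The bound is uniform in n: on the second quarter of the period that
    follows a, cos is nonpositive, so |s - 1|^2 is at least 2, while
    |z - crit a| is at most pi / l. *)
Lemma energy_source_ge n :
  ((l / (4 * pi))%:E <= energy (quotient_at (period_point n) source_num \o crit))%E.
Proof.
set a := period_point n.
have [hN [K K0 NK]] := lipschitz_left_source_num.
have mf := cmeasurable_quotient_crit a K0 NK.
have pi0 := pi_gt0 R.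
have lb y : y \in `[a + pi / (2 * l), a + pi / l] ->
    l ^+ 2 / (2 * pi ^+ 2) <= normc (quotient_at a source_num (crit y)) ^+ 2.
  move=> yI; have /andP[y1 y2] : a + pi / (2 * l) <= y <= a + pi / l.
    by move: yI; rewrite in_itv.
  have cl : complex.Re (crit y) <= 2^-1 by exact: lexx.
  have y3 : pi / 2 <= (y - a) * l.
    rewrite -ler_pdivrMr// (_ : pi / 2 / l = pi / (2 * l)); first lra.
    by move: (@pi R) pi0 => P P0; field; rewrite gt_eqF.
  have y4 : (y - a) * l <= pi by rewrite -ler_pdivlMr//; lra.
  have ya : 0 < y - a by rewrite -(pmulr_lgt0 _ l0); lra.
  have cosle : cos (y * l) <= 0.
    have -> : y * l = (y - a) * l + pi *+ 2 *+ n by rewrite -period_pointM -mulrDl subrK.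
    rewrite (periodicn (@cosD2pi R)) -oppr_ge0 -sinBpihalf; apply: sin_ge0_pi; lra.
  have S1 : 2 <= normc (s (crit y) - 1) ^+ 2.
    rewrite inner_exp_crit sqr_normcE /= subr0.
    have := cos2Dsin2 (y * l); set X := cos (y * l) in cosle *; set Y := sin (y * l) => XY.
    rewrite [leRHS](_ : _ = (X ^+ 2 + Y ^+ 2) + 1 - 2 * X); [rewrite XY; lra|ring].
  have u2 : normc (u (crit y)) ^+ 2 <= 2 ^+ 2.
    rewrite ler_sqr ?nnegrE ?normc_ge0//; apply: (le_trans (normc_leB _ _)).
    rewrite normc1 normcM normc_real gtr0_norm//.
    have : q * normc (s (crit y)) <= q by rewrite ler_piMr ?(ltW q0)// normc_inner_exp_le1// ltW.
    by have := q1; lra.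
  have u3 : 0 < normc (u (crit y)) ^+ 2 by rewrite exprn_gt0// normc_gt0// symbol_den_neq0.
  rewrite /quotient_at /source_num !normcM !normcV !exprMn !exprVn.
  rewrite sqr_normc_sub_crit subrr (_ : 0 ^+ 2 = 0 :> R) ?add0r; last by rewrite expr0n.
  have h : (y - a) ^+ 2 <= (pi / l) ^+ 2 by rewrite ler_sqr ?nnegrE; lra.
  have ya2 : 0 < (y - a) ^+ 2 by rewrite exprn_gt0.
  rewrite (_ : l ^+ 2 / _ = 2 / 2 ^+ 2 / (pi / l) ^+ 2); last first.
    by move: (@pi R) pi0 => P P0; field; rewrite !gt_eqF.
  apply: ler_pM.
  - by rewrite divr_ge0 ?exprn_ge0.
  - by rewrite invr_ge0 sqr_ge0.
  - have u4 : 0 < 2 ^+ 2 :> R by rewrite exprn_gt0.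
    by apply: ler_pM; rewrite ?lef_pV2 ?posrE// invr_ge0 ltW.
  - by rewrite lef_pV2 ?posrE ?exprn_gt0.
pose I : set R := `[a + pi / (2 * l), a + pi / l]%classic.
have mI : measurable I by exact: measurable_itv.
have ab : pi / (2 * l) < pi / l.
  rewrite (_ : pi / (2 * l) = pi / l / 2); first by have := pil0; lra.
  by move: (@pi R) pi0 => P P0; field; rewrite gt_eqF.
apply: (@le_trans _ _ (\int[mu]_(y in I)
    cst (l ^+ 2 / (2 * pi ^+ 2))%:E y)%E).
  rewrite integral_cst//= lebesgue_measure_itv/= lte_fin ltrD2l ab -EFinB -EFinM lee_fin.
  rewrite le_eqVlt; apply/orP; left; apply/eqP.
  by move: (@pi R) pi0 => P P0; field; rewrite !gt_eqF.
apply: (@le_trans _ _ (\int[mu]_(y in I)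
    (normc (quotient_at a source_num (crit y)) ^+ 2)%:E)%E).
  apply: ge0_le_integral => //.
  - by move=> y _; rewrite lee_fin divr_ge0 ?sqr_ge0// mulr_ge0// sqr_ge0.
  - by apply/measurable_EFinP; apply: measurable_funTS; exact: (measurable_sqr_normc mf).
rewrite /energy; apply: (@ge0_subset_integral _ _ _ mu I setT mI measurableT) => //.
- by apply/measurable_EFinP; exact: (measurable_sqr_normc mf).
- by move=> y _; rewrite lee_fin sqr_ge0.
Qed.

(** For fixed y the denominator runs off to infinity. *)
Lemma quotient_period_point_cvg0 (N : C -> C) (K y : R) : 0 <= K ->
  (forall z w, complex.Re z <= 2^-1 -> complex.Re w <= 2^-1 ->
    normc (N z) <= K /\ normc (N z - N w) <= K * normc (z - w)) ->
  normc (quotient_at (period_point n) N (crit y)) @[n --> \oo] --> (0 : R).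
Proof.
move=> K0 NK; apply/cvgrPdist_le => e e0.
have pi0 := pi_gt0 R.
pose D := `|y| + (K + 1) / e.
exists (Num.bound (D * l)) => // n /= nD.
rewrite sub0r normrN ger0_norm ?normc_ge0// /quotient_at normcM normcV.
have D0 : 0 <= D by rewrite addr_ge0// divr_ge0 ?(ltW e0)// addr_ge0.
have an : D <= period_point n.
  rewrite /period_point ler_pdivlMr//.
  apply: (le_trans (ltW (archi_boundP _))); first by rewrite mulr_ge0// ltW.
  apply: (@le_trans _ _ n%:R); first by rewrite ler_nat.
  rewrite -(mulr_natl (pi *+ 2) n); apply: ler_peMr => //.
  by have := @pi_ge2 R; rewrite mulr2n; lra.
have far : (K + 1) / e <= normc (crit y - crit (period_point n)).
  apply: le_trans (Im_le_normc _); rewrite /= distrC.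
  apply: le_trans (ler_norm _); move: an; rewrite /D.
  by have := ler_norm y; lra.
have Ke : 0 < (K + 1) / e by rewrite divr_gt0// ltr_wpDl.
rewrite ler_pdivrMr ?(lt_le_trans Ke)//.
have [b _] := NK (crit y) (crit y) (lexx _) (lexx _).
apply: (le_trans b); apply: (@le_trans _ _ (e * ((K + 1) / e))).
  by rewrite mulrC divfK ?gt_eqF// lerDl.
by rewrite ler_pM2l.
Qed.

End explicit_functions.

(** * The Hankel operator of rho *)

Section rho_hankel.
Context {R : realType}.
Local Notation C := R[i].
Local Notation mu := (@lebesgue_measure R).

(** On the critical line the numerator and the denominator of rho are complex
    conjugates. *)
Lemma rho_crit (p : nat) (y : R) : let l := ln p%:R in
  let v := 1 - (expR (- 2^-1 * l))%:C * inner_exp l (crit y) in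
  rho p (crit y) = v / conjc v.
Proof.
move=> l v; rewrite /rho.
have num : natpow p (crit y - 1) = (expR (- 2^-1 * l))%:C * inner_exp l (crit y).
  rewrite inner_exp_crit /natpow /cexp /crit /= -/l; simpc.
  by congr (expR _ * _ +i* (expR _ * _)); lra.
have den : natpow p (- crit y) = conjc (natpow p (crit y - 1)).
  rewrite /natpow /cexp /crit /= -/l; simpc.
  have -> : (2^-1 - 1) * l = - (2^-1 * l) by lra.
  by rewrite cosN sinN mulrN.
rewrite den num -/v (_ : 1 - conjc _ = conjc v)//.
have -> : (1 : C) = conjc 1 by exact/esym/rmorph1.
by rewrite /v; apply/esym; exact: rmorphB.
Qed.

Lemma normc_conj (z : C) : normc (conjc z) = normc z.
Proof. by case: z => a b; rewrite /normc /= sqrrN. Qed.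

Lemma normc_rho_crit (p : nat) (y : R) : prime p -> normc (rho p (crit y)) = 1.
Proof.
move=> pp; have l0 : 0 < ln p%:R :> R by rewrite ln_gt0// ltr1n prime_gt1.
rewrite rho_crit normcM normcV normc_conj divff//.
have v0 := symbol_den_neq0 l0 (lexx _ : complex.Re (crit y) <= 2^-1).
by apply: contra_neq v0; exact: eq0_normc.
Qed.

End rho_hankel.

Theorem fact3p6 (R : realType) (p : nat) (hp : prime p) :
  ~ quasi_inner (@rho R p).
Proof.
move=> [[mrho _] cpt].
pose l : R := ln p%:R.
have l0 : 0 < l by rewrite ln_gt0// ltr1n prime_gt1.
have rho1 (y : R) := normc_rho_crit y hp.
pose q : R := expR (- 2^-1 * l).
have q0 : 0 < q by exact: expR_gt0.
pose a := period_point l.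
pose f n := quotient_at (a n) (source_num l) \o crit.
pose h n := quotient_at (a n) (fejer_num l) \o crit.
pose k n := quotient_at (a n) (test_num l) \o crit.
have [hNf [Kf Kf0 NfK]] := lipschitz_left_source_num l0.
have [hNh [Kh Kh0 NhK]] := lipschitz_left_fejer_num l0.
have [hNk [Kk Kk0 NkK]] := lipschitz_left_test_num l0.
have fa n : source_num l (crit (a n)) = 0 by exact: source_num_period_point.
have ha n : fejer_num l (crit (a n)) = 0 by exact: fejer_num_period_point.
have ka n : test_num l (crit (a n)) = 0 by exact: test_num_period_point.
have fH n : H2 (f n) := H2_quotient hNf Kf0 (fa n) NfK.
have hH n : H2 (h n) := H2_quotient hNh Kh0 (ha n) NhK.
have k2 n : L2 (k n) := L2_quotient hNk Kk0 (ka n) NkK.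
have kperp n g : H2 g -> \int[lebesgue_measure]_y complex.Re (g y * k n y) = 0.
  exact: (H2_pairing_quotient hNk Kk0 (ka n) NkK).
have hh n : \int[lebesgue_measure]_y complex.Re (h n y * h n y) = 0.
  exact: (H2_pairing_quotient hNh Kh0 (ha n) NhK).
have fB n : (energy (f n) <= (2 * Kf ^+ 2 * pi)%:E)%E.
  exact: (energy_quotient_bounded hNf Kf0 (fa n) NfK (lexx _)).
pose B := 2 * Kk ^+ 2 * pi + 1.
have B0 : 0 < B by rewrite ltr_wpDl// !mulr_ge0 ?sqr_ge0 ?pi_ge0.
have kB n : (energy (k n) <= B%:E)%E.
  apply: le_trans (energy_quotient_bounded hNk Kk0 (ka n) NkK (lexx _)) _.
  by rewrite lee_fin lerDl.
pose c := q * (l / (4 * pi)).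
have c0 : 0 < c by rewrite mulr_gt0// divr_gt0// mulr_gt0// pi_gt0.
have hank n : L2 (hankel (rho p) (f n)) /\
    c <= \int[lebesgue_measure]_y complex.Re (hankel (rho p) (f n) y * k n y).
  have [T2 ->] := hankel_pairing mrho rho1 (fH n) (k2 n) (kperp n).
  split=> //.
  have f2 := (fH n).1; have h2 := (hH n).1.
  have [ih _] := L2_mul_integrable h2 h2.
  have [ff _] := L2_mul_integrable f2 (L2_conj f2).
  have -> : \int[lebesgue_measure]_y complex.Re (rho p (crit y) * f n y * k n y) =
      \int[lebesgue_measure]_y (complex.Re (h n y * h n y)
        + q * complex.Re (f n y * conjc (f n y))).
    apply: eq_Rintegral => y _.
    have -> : complex.Re (f n y * conjc (f n y)) = normc (f n y) ^+ 2.
      by rewrite sqr_normcE; case: (f n y) => ? ? /=; ring.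
    by rewrite rho_crit (rho_product_id l0 y (a n)); case: (_ * _).
  rewrite RintegralD//; last first.
    have := integrableZl measurableT q ff; apply: eq_integrable => //.
  rewrite hh add0r RintegralZl// /c ler_pM2l// -lee_fin (energy_Rintegral f2).
  exact: energy_source_ge.
have f2 n : L2 (f n) := (fH n).1.
(* Weak convergence makes the pairing of the limit g with k n tend to 0, and
   norm convergence makes it stay close to that of the images, at least c. *)
have [phi [phi_incr [g g2 Tg]]] : exists phi : nat -> nat, {homo phi : m n / (m < n)%N} /\
    exists2 g, L2 g &
      norm2 (hankel (rho p) (f (phi n)) \- g) @[n --> \oo] --> (0 : \bar R)%E.
  apply: cpt => //; exists (Num.sqrt (2 * Kf ^+ 2 * pi)) => n.
  by rewrite norm2_le ?sqrtr_ge0// sqr_sqrtr// !mulr_ge0 ?sqr_ge0 ?pi_ge0.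
have phi_ge n : (n <= phi n)%N.
  by elim: n => // n IH; apply: (leq_ltn_trans IH); exact: phi_incr.
have kcvg (y : R) : normc (k n y) @[n --> \oo] --> (0 : R).
  exact: (quotient_period_point_cvg0 l0 y Kk0 NkK).
have c3 : 0 < c / 3 by rewrite divr_gt0.
have [N NP] := weak_cvg0 g2 k2 kB kcvg c3.
(* With this weight d the test function and the difference from the limit
   contribute c / 6 each. *)
pose d := 6 * B / c.
have d0 : 0 < d by rewrite divr_gt0// mulr_gt0.
have eta0 : 0 < c / (6 * d) by rewrite divr_gt0// mulr_gt0.
have [N' _ N'P] := (norm2_cvg0P _).1 Tg _ eta0.
pose n := maxn N N'.
have small1 := NP (phi n) (leq_trans (leq_maxl _ _) (phi_ge n)).
have Tgn : (energy (hankel (rho p) (f (phi n)) \- g)%R <= (c / (6 * d))%:E)%E.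
  exact: N'P (leq_maxr _ _).
have [T2 big] := hank (phi n).
have small2 := Rintegral_Re_mul_le (L2_sub T2 g2) (k2 (phi n)) Tgn (kB (phi n)) d0.
have [i1 _] := L2_mul_integrable (L2_sub T2 g2) (k2 (phi n)).
have [i2 _] := L2_mul_integrable g2 (k2 (phi n)).
have E : \int[lebesgue_measure]_y complex.Re (hankel (rho p) (f (phi n)) y * k (phi n) y) =
    \int[lebesgue_measure]_y complex.Re ((hankel (rho p) (f (phi n)) \- g) y * k (phi n) y)
    + \int[lebesgue_measure]_y complex.Re (g y * k (phi n) y).
  rewrite -RintegralD//; apply: eq_Rintegral => y _ /=.
  by case: (hankel _ _ _) (g y) (k _ y) => [? ?] [? ?] [? ?] /=; ring.
have dB : d * (c / (6 * d)) + d^-1 * B = c / 3.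
  by rewrite /d; field; rewrite !gt_eqF.
rewrite dB in small2; rewrite E in big.
move: small1 small2; rewrite !ler_norml => /andP[_ s1] /andP[_ s2].
move: big; rewrite leNgt => /negP; apply.
by apply: (le_lt_trans (lerD s2 s1)); move: c0; clear; lra.
Qed.
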